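(* Let $k$ be a field of characteristic $0$. If a nc rational function $\mathbb r$ over $k$ in $x_1,\dots,x_g$ is irreducible, then $\operatorname{dom}\mathbb r$ is co-irreducible. Conversely, for every co-irreducible set $D\in\mathfrak{Dom}_0$ there exist a unique $d\in\mathbb N$ and a monic linear pencil $L$ of size $d$ such that the irreducible nc rational functions whose domains are $D$ are exactly those of the form $$\mathbf c^tL^{-1}\mathbf b,\qquad\mathbf b,\mathbf c\in k^d\setminus\{0\}.$$
   Context: Nc rational functions. Let $k\langle x\rangle=k\langle x_1,\dots,x_g\rangle$ be the free $k$-algebra of noncommutative (nc) polynomials. A nc rational expression is a syntactically valid combination of nc polynomials, the operations $+,\cdot,{}^{-1}$ and parentheses. An expression $r$ can be evaluated at $X\in M_n(k)^g$ whenever all inverses appearing in $r$ exist at $X$; $\operatorname{dom}_n r$ is the set of such $X$ and $\operatorname{dom} r=\bigcup_n\operatorname{dom}_n r$. Expressions $r_1,r_2$ with nonempty domains are equivalent if $r_1(X)=r_2(X)$ for all $X\in\operatorname{dom} r_1\cap\operatorname{dom} r_2$. Nc rational functions are the equivalence classes; they form a skew field. For a nc rational function $\mathbb r$, $\operatorname{dom}_n\mathbb r$ is the union of $\operatorname{dom}_n r$ over all representatives $r$ of $\mathbb r$, and $\operatorname{dom}\mathbb r=\bigcup_n\operatorname{dom}_n\mathbb r$. Pencils. A monic linear pencil of size $d$ is $L_A=I_d-\sum_iA_ix_i$ with $A_i\in M_d(k)$; for $X\in M_n(k)^g$, $L_A(X)=I_d\otimes I_n-\sum_iA_i\otimes X_i$;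 its free locus is $\mathscr Z(L_A)=\bigcup_n\{X\in M_n(k)^g:\det L_A(X)=0\}$. A monic pencil $L$ is minimal if it has the smallest size among all monic pencils with free locus $\mathscr Z(L)$. A minimal pencil $L_A$ is irreducible if the (possibly non-unital) $k$-algebra generated by $A_1,\dots,A_g$ is simple (with nonzero multiplication). Domains. $\mathfrak{Dom}_0=\{\operatorname{dom}\mathbb r: \mathbb r \text{ a nc rational function with } 0\in\operatorname{dom}\mathbb r\}$. A set $D\in\mathfrak{Dom}_0$ is co-irreducible if $D\neq\bigcup_nM_n(k)^g$ and $D$ is not an intersection of two strictly larger sets in $\mathfrak{Dom}_0$ (equivalently, $D$ is the complement of an irreducible free locus, where a free locus is irreducible if it is nonempty and not a union of two strictly smaller free loci). A nonzero nc rational function $\mathbb r$ with $0\in\operatorname{dom}\mathbb r$ is irreducible if $\mathbb r=\mathbf c^tL^{-1}\mathbf b$ for some irreducible monic pencil $L$ and vectors $\mathbf b,\mathbf c$ over $k$. *)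

(* Defs.v *)
From mathcomp Require Export all_boot all_order all_algebra.
From mathcomp Require Export boolp classical_sets.
From mathcomp.real_closed Require Export mxtens.
Set Implicit Arguments.
Unset Strict Implicit.
Unset Printing Implicit Defensive.
Import GRing.Theory.
Local Open Scope classical_set_scope.
Local Open Scope ring_scope.

(* The disjoint union of the M_n(k)^g over n >= 1; [existT _ n X] is a
   g-tuple of matrices of size n.+1. *)
Definition mtuple (k : fieldType) (g : nat) : Type :=
  {n : nat & 'I_g -> 'M[k]_n.+1}.

(* The origin of k^g = M_1(k)^g. *)
Definition origin (k : fieldType) (g : nat) : mtuple k g :=
  existT (fun n => 'I_g -> 'M[k]_n.+1) 0%N (fun=> 0).

(* Nc polynomials are the expressions without [NcInv]; subtraction is
   addition of a multiple by the constant -1. *)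
Inductive ncexpr (k : fieldType) (g : nat) : Type :=
| NcConst of k
| NcVar of 'I_g
| NcAdd of ncexpr k g & ncexpr k g
| NcMul of ncexpr k g & ncexpr k g
| NcInv of ncexpr k g.

Arguments NcConst {k g} _.
Arguments NcVar {k g} _.

Section Expressions.
Variables (k : fieldType) (g : nat).
Implicit Types (r s : ncexpr k g) (X : mtuple k g).

(* [None] when some inverse occurring in r does not exist at X. *)
Fixpoint nceval n (X : 'I_g -> 'M[k]_n.+1) r : option 'M[k]_n.+1 :=
  match r with
  | NcConst a => Some a%:M
  | NcVar i => Some (X i)
  | NcAdd r1 r2 =>
      if (nceval X r1, nceval X r2) is (Some u, Some v)
      then Some (u + v) else None
  | NcMul r1 r2 =>
      if (nceval X r1, nceval X r2) is (Some u, Some v)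
      then Some (u *m v) else None
  | NcInv r1 =>
      if nceval X r1 is Some u
      then if u \in unitmx then Some (invmx u) else None
      else None
  end.

Definition expr_dom r : set (mtuple k g) :=
  [set X | isSome (nceval (projT2 X) r)].

Definition expr_equiv r s : Prop :=
  [/\ expr_dom r !=set0, expr_dom s !=set0 &
      forall X, expr_dom r X -> expr_dom s X ->
        nceval (projT2 X) r = nceval (projT2 X) s].

Record ncratfun := NcRatFun {
  representatives :> set (ncexpr k g);
  ncratfunP : exists2 r, expr_dom r !=set0 &
                representatives = [set s | expr_equiv r s] }.

Definition dom (f : ncratfun) : set (mtuple k g) :=
  \bigcup_(r in representatives f) expr_dom r.

Definition ncmulmx m n p (M : 'M[ncexpr k g]_(m, n)) (N : 'M[ncexpr k g]_(n, p))
    : 'M[ncexpr k g]_(m, p) :=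
  \matrix_(i, j) \big[@NcAdd k g/NcConst 0]_(l < n) NcMul (M i l) (N l j).

Definition equivmx m n (M N : 'M[ncexpr k g]_(m, n)) : Prop :=
  forall i j, expr_equiv (M i j) (N i j).

Definition constmx m n (C : 'M[k]_(m, n)) : 'M[ncexpr k g]_(m, n) :=
  map_mx NcConst C.

End Expressions.

Section Pencils.
Variables (k : fieldType) (g : nat).

(* A monic pencil L_A of size d is given by its coefficients
   A : 'I_g -> 'M[k]_d. *)

Definition pencil_eval d (A : 'I_g -> 'M[k]_d) n (X : 'I_g -> 'M[k]_n)
    : 'M[k]_(d * n) :=
  1%:M *t 1%:M - \sum_(i < g) A i *t X i.

Definition free_locus d (A : 'I_g -> 'M[k]_d) : set (mtuple k g) :=
  [set X | \det (pencil_eval A (projT2 X)) = 0].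

Definition minimal_pencil d (A : 'I_g -> 'M[k]_d) : Prop :=
  forall e (B : 'I_g -> 'M[k]_e), free_locus B = free_locus A -> (d <= e)%N.

(* The k-algebra generated by the A i; it need not contain 1%:M. *)
Inductive generated_alg d (A : 'I_g -> 'M[k]_d) : set 'M[k]_d :=
| gen_coef i : generated_alg A (A i)
| gen_zero : generated_alg A 0
| gen_add U V : generated_alg A U -> generated_alg A V ->
    generated_alg A (U + V)
| gen_scale a U : generated_alg A U -> generated_alg A (a *: U)
| gen_mul U V : generated_alg A U -> generated_alg A V ->
    generated_alg A (U *m V).

Definition alg_ideal d (S J : set 'M[k]_d) : Prop :=
  [/\ J `<=` S, J 0,
      forall a U V, J U -> J V -> J (a *: U + V) &
      forall U V, S U -> J V -> J (U *m V) /\ J (V *m U)].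

Definition simple_alg d (S : set 'M[k]_d) : Prop :=
  (exists U V, [/\ S U, S V & U *m V != 0]) /\
  (forall J, alg_ideal S J -> J = [set 0] \/ J = S).

Definition irreducible_pencil d (A : 'I_g -> 'M[k]_d) : Prop :=
  minimal_pencil A /\ simple_alg (generated_alg A).

(* L_A as a matrix of nc polynomials. *)
Definition pencil_mx d (A : 'I_g -> 'M[k]_d) : 'M[ncexpr k g]_d :=
  \matrix_(i, j) NcAdd (NcConst (1%:M i j))
    (\big[@NcAdd k g/NcConst 0]_(l < g) NcMul (NcConst (- A l i j)) (NcVar l)).

(* M represents the inverse of L_A in the ring of d x d matrices over the
   skew field of nc rational functions. *)
Definition pencil_inverse d (A : 'I_g -> 'M[k]_d) (M : 'M[ncexpr k g]_d)
    : Prop :=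
  equivmx (ncmulmx (pencil_mx A) M) (constmx g 1%:M) /\
  equivmx (ncmulmx M (pencil_mx A)) (constmx g 1%:M).

(* f = c^t L_A^-1 b *)
Definition has_realization (f : ncratfun k g) d (c : 'cV[k]_d)
    (A : 'I_g -> 'M[k]_d) (b : 'cV[k]_d) : Prop :=
  exists2 M, pencil_inverse A M &
    representatives f
      (ncmulmx (ncmulmx (constmx g c^T) M) (constmx g b) 0 0).

Definition irreducible_fun (f : ncratfun k g) : Prop :=
  [/\ ~ representatives f (NcConst 0), dom f (origin k g) &
      exists d (A : 'I_g -> 'M[k]_d) (b c : 'cV[k]_d),
        irreducible_pencil A /\ has_realization f c A b].

Definition Dom0 : set (set (mtuple k g)) :=
  [set D | exists2 f : ncratfun k g, dom f (origin k g) & D = dom f].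

Definition coirreducible (D : set (mtuple k g)) : Prop :=
  [/\ Dom0 D, D <> setT &
      ~ exists D1 D2, [/\ Dom0 D1, Dom0 D2, D `<` D1, D `<` D2 &
                          D = D1 `&` D2]].

End Pencils.

(* Main.v *)
(** A rational function regular at the origin is c^t L^-1 b with L monic, and after
   discarding uncontrollable and unobservable parts the coefficients of L, b, c
   form a minimal realization. Evaluating any expression for the function at
   upper triangular points [[T2, *, *], [0, tX, *], [0, 0, T1]] shows that the entries
   of K L(tX)^-1 K, with K = 1 - L, have no pole at t = 1 once the expression is
   defined at X; hence neither has L(tX)^-1, and the domain of the function is exactly
   the set where L is invertible. Conversely, where L is invertible at X,
   Cayley-Hamilton gives a polynomial P with (P L)(X) = 1 and Gaussian elimination
   on P L never meets a singular pivot at X.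

   If A, C are irreducible and Z(C) is contained in Z(A), then p(A) = 0 implies
   p(C) = 0: otherwise some such p has a fixed vector at C, and the
   domain of (1 - p)^-1 contains A and not C, so the transposed coefficients of
   its minimal realization separate the free loci. So C is a module over the algebra
   of A and the two tuples are similar. The free locus of any pencil is
   therefore the union of those of its composition factors, each of which is
   determined up to similarity by its locus. *)

(* Domains of two representatives need not meet where these are to be compared. Comparisons are
   therefore made at generic points of a line or of a ray tX, where all quantities are rational in
   the one parameter t, and carried back to the given point. Over an infinite field two nonempty
   open subsets of the line meet, and the origin, where a monic pencil is the identity, makes the
   pencil invertible at generic points of every ray.

   Kronecker products are avoided: L_A(X) is replaced by the operator sending V to V minus the sum
   of the X_i V F_i on n x d matrices, with F_i the transpose of A_i. Its symmetry between X and F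
   lets the coefficients of one pencil serve as a point for another, and the separation of free loci
   rests on this. *)
Require Import Defs.
Set Implicit Arguments.
Unset Strict Implicit.
Unset Printing Implicit Defensive.
Import GRing.Theory.
Local Open Scope classical_set_scope.
Local Open Scope ring_scope.

(** * Regular functions of one parameter *)

Section RegularFunctions.
Variable k : fieldType.
Implicit Types (t : k) (f g : k -> k).

(** Validity on a Zariski neighbourhood of [t0] in the affine line. *)
Definition znear t0 (P : k -> Prop) :=
  exists2 p : {poly k}, p.[t0] != 0 & forall t, p.[t] != 0 -> P t.

Lemma znearT t0 (P : k -> Prop) : (forall t, P t) -> znear t0 P.
Proof. by move=> HP; exists 1; rewrite ?hornerC ?oner_neq0. Qed.

Lemma znear_mono t0 (P Q : k -> Prop) :
  (forall t, P t -> Q t) -> znear t0 P -> znear t0 Q.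
Proof. by move=> PQ [p p0 Pp]; exists p => // t /Pp/PQ. Qed.

Lemma znear_and t0 (P Q : k -> Prop) :
  znear t0 P -> znear t0 Q -> znear t0 (fun t => P t /\ Q t).
Proof.
move=> [p p0 Pp] [q q0 Qq]; exists (p * q); first by rewrite hornerM mulf_neq0.
by move=> t; rewrite hornerM mulf_eq0 negb_or => /andP[/Pp ? /Qq ?].
Qed.

Lemma znear_all t0 (I : finType) (P : I -> k -> Prop) :
  (forall i, znear t0 (P i)) -> znear t0 (fun t => forall i, P i t).
Proof.
move=> H; have Hs (s : seq I) : znear t0 (fun t => forall i, i \in s -> P i t).
  elim: s => [|i s IH]; first by apply: znearT.
  apply: znear_mono (znear_and (H i) IH) => t [Pi Ps] j.
  by rewrite inE => /predU1P[->|/Ps].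
by apply: znear_mono (Hs (enum I)) => t Pt i; apply: Pt; rewrite mem_enum.
Qed.

(** The fraction must agree with f at [t0] itself, while f may take arbitrary values at the finitely
    many zeros of the denominator. *)
Definition reg t0 f :=
  exists pq : {poly k} * {poly k}, pq.2.[t0] != 0 /\
    forall t, pq.2.[t] != 0 -> f t = pq.1.[t] / pq.2.[t].

Lemma reg_ext t0 f g : f =1 g -> reg t0 f -> reg t0 g.
Proof. by move=> fg [pq [q0 H]]; exists pq; split=> // t /H <-. Qed.

Lemma reg_poly t0 (p : {poly k}) : reg t0 (fun t => p.[t]).
Proof.
exists (p, 1) => /=; split=> [|t _]; first by rewrite hornerC oner_neq0.
by rewrite hornerC divr1.
Qed.

Lemma reg_const t0 a : reg t0 (fun=> a).
Proof. by apply: reg_ext (reg_poly t0 a%:P) => t; rewrite hornerC. Qed.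

Lemma reg_id t0 : reg t0 id.
Proof. by apply: reg_ext (reg_poly t0 'X) => t; rewrite hornerX. Qed.

Lemma reg_add t0 f g : reg t0 f -> reg t0 g -> reg t0 (fun t => f t + g t).
Proof.
move=> [[p q] /= [q0 H]] [[p' q'] /= [q'0 H']].
exists (p * q' + p' * q, q * q') => /=; rewrite hornerM mulf_neq0 //; split=> // t.
rewrite !hornerE mulf_eq0 negb_or => /andP[qt q't].
by rewrite H // H' // addf_div.
Qed.

Lemma reg_mul t0 f g : reg t0 f -> reg t0 g -> reg t0 (fun t => f t * g t).
Proof.
move=> [[p q] /= [q0 H]] [[p' q'] /= [q'0 H']].
exists (p * p', q * q') => /=; rewrite hornerM mulf_neq0 //; split=> // t.
rewrite !hornerE mulf_eq0 negb_or => /andP[qt q't].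
by rewrite H // H' // mulf_div.
Qed.

Lemma reg_near t0 f : reg t0 f -> f t0 != 0 -> znear t0 (fun t => f t != 0).
Proof.
move=> [[p q] /= [q0 H]] f0; exists (p * q).
  by move: f0; rewrite H // hornerM !mulf_eq0 !negb_or => /andP[-> _].
move=> t; rewrite hornerM mulf_eq0 negb_or => /andP[pt qt].
by rewrite H // mulf_neq0 ?invr_eq0.
Qed.

Lemma reg_inv t0 f : reg t0 f -> f t0 != 0 -> reg t0 (fun t => (f t)^-1).
Proof.
move=> [[p q] /= [q0 H]] f0; exists (q * q, p * q) => /=; split=> [|t].
  by move: f0; rewrite H // hornerM !mulf_eq0 !negb_or => /andP[-> _].
rewrite !hornerM mulf_eq0 negb_or => /andP[pt qt].
by rewrite H // -mulf_div divff // mulr1 invf_div.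
Qed.

Lemma reg_sum t0 (I : Type) (r : seq I) (P : pred I) (F : I -> k -> k) :
  (forall i, reg t0 (F i)) -> reg t0 (fun t => \sum_(i <- r | P i) F i t).
Proof.
move=> H; elim: r => [|i r IH].
  by apply: reg_ext (reg_const t0 0) => t; rewrite big_nil.
case Pi: (P i).
  by apply: reg_ext (reg_add (H i) IH) => t; rewrite big_cons Pi.
by apply: reg_ext IH => t; rewrite big_cons Pi.
Qed.

Lemma reg_prod t0 (I : Type) (r : seq I) (P : pred I) (F : I -> k -> k) :
  (forall i, reg t0 (F i)) -> reg t0 (fun t => \prod_(i <- r | P i) F i t).
Proof.
move=> H; elim: r => [|i r IH].
  by apply: reg_ext (reg_const t0 1) => t; rewrite big_nil.
case Pi: (P i).
  by apply: reg_ext (reg_mul (H i) IH) => t; rewrite big_cons Pi.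
by apply: reg_ext IH => t; rewrite big_cons Pi.
Qed.

Lemma reg_znear_eq t0 f g : reg t0 f -> znear t0 (fun t => f t = g t) -> reg t0 g.
Proof.
move=> [[p q] /= [q0 H]] [s s0 Hs]; exists (p * s, q * s) => /=.
rewrite hornerM mulf_neq0 //; split=> // t.
rewrite !hornerM mulf_eq0 negb_or => /andP[qt st].
by rewrite -Hs // H // -mulf_div divff // mulr1.
Qed.

Definition regmx t0 m n (F : k -> 'M[k]_(m, n)) :=
  forall i j, reg t0 (fun t => F t i j).

Lemma regmx_ext t0 m n (F G : k -> 'M[k]_(m, n)) :
  F =1 G -> regmx t0 F -> regmx t0 G.
Proof. by move=> FG H i j; apply: reg_ext (H i j) => t; rewrite FG. Qed.

Lemma regmx_const t0 m n (A : 'M[k]_(m, n)) : regmx t0 (fun=> A).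
Proof. by move=> i j; exact: reg_const. Qed.

Lemma regmx_add t0 m n (F G : k -> 'M[k]_(m, n)) :
  regmx t0 F -> regmx t0 G -> regmx t0 (fun t => F t + G t).
Proof. by move=> HF HG i j; apply: reg_ext (reg_add (HF i j) (HG i j)) => t; rewrite mxE. Qed.

Lemma regmx_scale t0 m n a (F : k -> 'M[k]_(m, n)) :
  reg t0 a -> regmx t0 F -> regmx t0 (fun t => a t *: F t).
Proof. by move=> Ha HF i j; apply: reg_ext (reg_mul Ha (HF i j)) => t; rewrite mxE. Qed.

Lemma regmx_opp t0 m n (F : k -> 'M[k]_(m, n)) :
  regmx t0 F -> regmx t0 (fun t => - F t).
Proof.
move=> HF; apply: regmx_ext (regmx_scale (reg_const t0 (-1)) HF) => t.
by rewrite scaleN1r.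
Qed.

Lemma regmx_mul t0 m n p (F : k -> 'M[k]_(m, n)) (G : k -> 'M[k]_(n, p)) :
  regmx t0 F -> regmx t0 G -> regmx t0 (fun t => F t *m G t).
Proof.
move=> HF HG i j; have := reg_sum (index_enum 'I_n) xpredT (fun l => reg_mul (HF i l) (HG l j)).
by apply: reg_ext => t; rewrite mxE.
Qed.

Lemma regmx_sum t0 m n (I : Type) (r : seq I) (P : pred I) (F : I -> k -> 'M[k]_(m, n)) :
  (forall i, regmx t0 (F i)) -> regmx t0 (fun t => \sum_(i <- r | P i) F i t).
Proof.
move=> H i j; have := reg_sum r P (fun l => H l i j).
by apply: reg_ext => t; rewrite summxE.
Qed.

Lemma reg_det t0 n (F : k -> 'M[k]_n) : regmx t0 F -> reg t0 (fun t => \det (F t)).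
Proof.
move=> H; apply: reg_sum => s; apply: reg_mul; first exact: reg_const.
by apply: reg_prod => i; apply: H.
Qed.

Lemma regmx_unit t0 n (F : k -> 'M[k]_n) :
  regmx t0 F -> F t0 \in unitmx -> znear t0 (fun t => F t \in unitmx).
Proof.
rewrite unitmxE unitfE => /reg_det H /(reg_near H).
by apply: znear_mono => t; rewrite unitmxE unitfE.
Qed.

Lemma regmx_inv t0 n (F : k -> 'M[k]_n) :
  regmx t0 F -> F t0 \in unitmx -> regmx t0 (fun t => invmx (F t)).
Proof.
move=> HF F0 i j.
have Fnear := regmx_unit HF F0.
have := F0; rewrite unitmxE unitfE => d0.
have adjreg : reg t0 (fun t => (\adj (F t)) i j).
  apply: (@reg_ext _ (fun t => (-1) ^+ (j + i) * \det (row' j (col' i (F t))))).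
    by move=> t; rewrite mxE.
  apply: reg_mul; first exact: reg_const.
  apply: reg_det => a b.
  by apply: reg_ext (HF (lift j a) (lift i b)) => t; rewrite !mxE.
(* [invmx] returns its argument at singular matrices, so the adjugate formula is available only near
   [t0]. *)
apply: reg_znear_eq (reg_mul (reg_inv (reg_det HF) d0) adjreg) _.
apply: znear_mono Fnear => t Ft.
by rewrite /invmx Ft [RHS]mxE.
Qed.

Lemma regmx_block t0 m1 m2 n1 n2 (A : k -> 'M[k]_(m1, n1)) (B : k -> 'M[k]_(m1, n2))
    (C : k -> 'M[k]_(m2, n1)) (D : k -> 'M[k]_(m2, n2)) :
  regmx t0 A -> regmx t0 B -> regmx t0 C -> regmx t0 D ->
  regmx t0 (fun t => block_mx (A t) (B t) (C t) (D t)).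
Proof.
move=> HA HB HC HD i j.
case: (split_ordP i) => i' ->; case: (split_ordP j) => j' ->.
- by apply: reg_ext (HA i' j') => t; rewrite block_mxEul.
- by apply: reg_ext (HB i' j') => t; rewrite block_mxEur.
- by apply: reg_ext (HC i' j') => t; rewrite block_mxEdl.
- by apply: reg_ext (HD i' j') => t; rewrite block_mxEdr.
Qed.

Lemma regmx_mxvec t0 m n (F : k -> 'M[k]_(m, n)) :
  regmx t0 F -> regmx t0 (fun t => mxvec (F t)).
Proof.
move=> HF i l; rewrite ord1; case/mxvec_indexP: l => a b.
by apply: reg_ext (HF a b) => t; rewrite mxvecE.
Qed.

Lemma regmx_vec_mx t0 m n (F : k -> 'rV[k]_(m * n)) :
  regmx t0 F -> regmx t0 (fun t => vec_mx (F t)).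
Proof.
move=> HF i j; apply: reg_ext (HF 0 (mxvec_index i j)) => t.
by rewrite mxE.
Qed.

Hypothesis char_k : [pchar k] =i pred0.

(** In characteristic 0 the numbers 0, 1, ..., [size p] - 1 are distinct in k, and they are one more
    than p can have roots. *)
Lemma poly_nonroot (p : {poly k}) : p != 0 -> exists t, p.[t] != 0.
Proof.
move=> p0; pose s : seq k := [seq n%:R | n <- iota 0 (size p)].
have us : uniq s.
  rewrite map_inj_uniq ?iota_uniq // => m n; wlog le_mn : m n / (m <= n)%N.
    by move=> H /[dup] e /esym e'; case/orP: (leq_total m n) => /H; [apply | move/(_ e')].
  move=> e; have: (n - m)%:R == 0 :> k by rewrite natrB // e subrr.
  by rewrite (pcharf0P k).1 // subn_eq0 => le_nm; apply/eqP; rewrite eqn_leq le_mn.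
have [/allP rts|] := boolP (all (root p) s).
  have := max_poly_roots p0 (introT allP rts) us.
  by rewrite size_map size_iota ltnn.
by case/allPn => t _ pt; exists t; rewrite -rootE.
Qed.

Lemma znear_meet t0 t1 P Q : znear t0 P -> znear t1 Q -> exists t, P t /\ Q t.
Proof.
move=> [p p0 Pp] [q q0 Qq]; have pq0 : p * q != 0.
  rewrite mulf_neq0 //; first by apply: contraNneq p0 => ->; rewrite horner0.
  by apply: contraNneq q0 => ->; rewrite horner0.
have [t] := poly_nonroot pq0; rewrite hornerM mulf_eq0 negb_or => /andP[/Pp ? /Qq ?].
by exists t.
Qed.

(** If f - g were nonzero at [t0], it would be nonzero on an open set, and this meets every
    neighbourhood of [t1]. *)
Lemma reg_eq t0 t1 f g : reg t0 f -> reg t0 g -> znear t1 (fun t => f t = g t) ->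
  f t0 = g t0.
Proof.
move=> Hf Hg Hfg; have Hd := reg_add Hf (reg_mul (reg_const t0 (-1)) Hg).
apply/eqP; rewrite -subr_eq0 -[- _]mulN1r; apply/negPn/negP => /(reg_near Hd) Hn.
have [t [/negP ne e]] := znear_meet Hn Hfg.
by case: ne; rewrite e mulN1r subrr.
Qed.

Lemma regmx_eq t0 t1 m n (F G : k -> 'M[k]_(m, n)) : regmx t0 F -> regmx t0 G ->
  znear t1 (fun t => F t = G t) -> F t0 = G t0.
Proof.
move=> HF HG H; apply/matrixP => i j; apply: reg_eq (HF i j) (HG i j) _.
by apply: znear_mono H => t ->.
Qed.

Definition zgen (P : k -> Prop) := exists t, znear t P.

Lemma znear_zgen t P : znear t P -> zgen P.
Proof. by exists t. Qed.

Lemma zgen_and P Q : zgen P -> zgen Q -> zgen (fun t => P t /\ Q t).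
Proof.
move=> [t0 [p p0 Pp]] [t1 [q q1 Qq]]; have pq0 : p * q != 0.
  rewrite mulf_neq0 //; first by apply: contraNneq p0 => ->; rewrite horner0.
  by apply: contraNneq q1 => ->; rewrite horner0.
have [t2 t2P] := poly_nonroot pq0; exists t2, (p * q) => // t.
by rewrite hornerM mulf_eq0 negb_or => /andP[/Pp ? /Qq].
Qed.

Lemma zgen_mono (P Q : k -> Prop) : (forall t, P t -> Q t) -> zgen P -> zgen Q.
Proof. by move=> PQ [t H]; exists t; exact: znear_mono H. Qed.

Lemma regmx_eq2 t0 t1 m n (F G : k -> 'M[k]_(m, n)) P Q : regmx t0 F -> regmx t0 G ->
  znear t0 P -> znear t1 Q -> (forall t, P t -> Q t -> F t = G t) -> F t0 = G t0.
Proof.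
move=> HF HG HP HQ H.
have [t2 PQ] : zgen (fun t => P t /\ Q t) by apply: zgen_and; eexists; eassumption.
by apply: (regmx_eq (t1 := t2) HF HG); apply: znear_mono PQ => t [/H].
Qed.

(* The value of [F] at [t0] itself is irrelevant. *)
Definition ext t0 m n (F : k -> 'M[k]_(m, n)) :=
  exists2 G, regmx t0 G & zgen (fun t => F t = G t).

Lemma ext_zgen t0 m n (F G : k -> 'M[k]_(m, n)) :
  ext t0 F -> zgen (fun t => F t = G t) -> ext t0 G.
Proof.
move=> [F' rF' FF'] FG; exists F' => //.
by apply: zgen_mono (zgen_and FF' FG) => t [<- <-].
Qed.

Lemma ext_add t0 m n (F G : k -> 'M[k]_(m, n)) :
  ext t0 F -> ext t0 G -> ext t0 (fun t => F t + G t).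
Proof.
move=> [F' rF' FF'] [G' rG' GG']; exists (fun t => F' t + G' t); first exact: regmx_add.
by apply: zgen_mono (zgen_and FF' GG') => t [-> ->].
Qed.

Lemma ext_mul t0 m n p q (A : 'M[k]_(m, n)) (F : k -> 'M[k]_(n, p)) (B : 'M[k]_(p, q)) :
  ext t0 F -> ext t0 (fun t => A *m F t *m B).
Proof.
move=> [F' rF' FF']; exists (fun t => A *m F' t *m B).
  by apply: regmx_mul; [apply: regmx_mul => //|]; exact: regmx_const.
by apply: zgen_mono FF' => t ->.
Qed.

Lemma ext_sum t0 m n (I : Type) (r : seq I) (F : I -> k -> 'M[k]_(m, n)) :
  (forall i, ext t0 (F i)) -> ext t0 (fun t => \sum_(i <- r) F i t).
Proof.
move=> H; elim: r => [|i r IH].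
  exists (fun=> 0); first exact: regmx_const.
  by exists t0; apply: znearT => t; rewrite big_nil.
apply: ext_zgen (ext_add (H i) IH) _; exists t0; apply: znearT => t.
by rewrite big_cons.
Qed.

Lemma ext_entries t0 m n (F : k -> 'M[k]_(m, n)) :
  (forall x y, ext t0 (fun t => (x : 'rV_m) *m F t *m (y : 'cV_n))) -> ext t0 F.
Proof.
move=> H.
have := ext_sum (index_enum 'I_m) (fun i => ext_sum (index_enum 'I_n) (fun j =>
  ext_mul (delta_mx i 0 : 'cV_m) (delta_mx 0 j : 'rV_n)
    (H (delta_mx 0 i) (delta_mx j 0)))).
move/ext_zgen; apply; exists t0; apply: znearT => t.
rewrite [RHS]matrix_sum_delta; apply: eq_bigr => i _; apply: eq_bigr => j _.
rewrite -rowE -colE; apply/matrixP => a b; rewrite !mxE big_ord1 !mxE big_ord1 !mxE.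
by rewrite !eqxx andbT /= -mulnb natrM mulrAC mulrC mulrA.
Qed.

End RegularFunctions.

(** * Evaluation of expressions *)

Section Evaluation.
Variables (k : fieldType) (g : nat).
Implicit Types (r s : ncexpr k g).

(** A total counterpart of [nceval], meaningful where [defined] holds. Size 0 is allowed so that
    block constructions may start from an empty block. *)
Fixpoint ev n (X : 'I_g -> 'M[k]_n) r : 'M[k]_n :=
  match r with
  | NcConst a => a%:M
  | NcVar i => X i
  | NcAdd r1 r2 => ev X r1 + ev X r2
  | NcMul r1 r2 => ev X r1 *m ev X r2
  | NcInv r1 => invmx (ev X r1)
  end.

Fixpoint defined n (X : 'I_g -> 'M[k]_n) r : bool :=
  match r with
  | NcConst a => true
  | NcVar i => true
  | NcAdd r1 r2 => defined X r1 && defined X r2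
  | NcMul r1 r2 => defined X r1 && defined X r2
  | NcInv r1 => defined X r1 && (ev X r1 \in unitmx)
  end.

Lemma ncevalE n (X : 'I_g -> 'M[k]_n.+1) r :
  nceval X r = if defined X r then Some (ev X r) else None.
Proof.
elim: r => //= [r1 -> r2 ->|r1 -> r2 ->|r1 ->].
- by case: (defined X r1); case: (defined X r2).
- by case: (defined X r1); case: (defined X r2).
- by case: (defined X r1).
Qed.

Lemma expr_domE r n (X : 'I_g -> 'M[k]_n.+1) :
  expr_dom r (existT (fun n => 'I_g -> 'M[k]_n.+1) n X) = defined X r :> Prop.
Proof. by rewrite /expr_dom /= ncevalE; case: (defined X r). Qed.

Lemma expr_equivP r s : expr_equiv r s ->
  forall n (X : 'I_g -> 'M[k]_n), defined X r -> defined X s -> ev X r = ev X s.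
Proof.
move=> [_ _ H] [|n] X rX sX; first by rewrite [LHS]flatmx0 [RHS]flatmx0.
have := H (existT (fun n => 'I_g -> 'M[k]_n.+1) n X).
by rewrite !expr_domE /= !ncevalE rX sX => /(_ isT isT)[].
Qed.

Definition somewhere r := exists n (X : 'I_g -> 'M[k]_n.+1), defined X r.

Lemma expr_dom_neq0 r : expr_dom r !=set0 <-> somewhere r.
Proof.
split=> [[[n X]]|[n [X rX]]]; first by rewrite expr_domE; exists n, X.
by exists (existT (fun n => 'I_g -> 'M[k]_n.+1) n X); rewrite expr_domE.
Qed.

Lemma expr_equivI r s : somewhere r -> somewhere s ->
  (forall n (X : 'I_g -> 'M[k]_n.+1), defined X r -> defined X s -> ev X r = ev X s) ->
  expr_equiv r s.
Proof.
move=> /expr_dom_neq0 r0 /expr_dom_neq0 s0 H; split=> // -[n X].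
by rewrite !expr_domE => rX sX; rewrite /= !ncevalE rX sX H.
Qed.

Lemma expr_equiv_sym r s : expr_equiv r s -> expr_equiv s r.
Proof. by case=> r0 s0 H; split=> // X sX rX; rewrite H. Qed.

Lemma expr_equiv_refl r : somewhere r -> expr_equiv r r.
Proof. by move=> r0; apply: expr_equivI. Qed.

Definition blk m n (X : 'I_g -> 'M[k]_m) (Z : 'I_g -> 'M[k]_(m, n))
    (T : 'I_g -> 'M[k]_n) : 'I_g -> 'M[k]_(m + n) :=
  fun i => block_mx (X i) (Z i) 0 (T i).

Lemma unitmx_ublock m n (A : 'M[k]_m) (B : 'M[k]_(m, n)) (D : 'M[k]_n) :
  (block_mx A B 0 D \in unitmx) = (A \in unitmx) && (D \in unitmx).
Proof. by rewrite !unitmxE det_ublock unitrM. Qed.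

Lemma invmx_ublock m n (A : 'M[k]_m) (B : 'M[k]_(m, n)) (D : 'M[k]_n) :
  A \in unitmx -> D \in unitmx ->
  invmx (block_mx A B 0 D) =
    block_mx (invmx A) (- (invmx A *m B *m invmx D)) 0 (invmx D).
Proof.
move=> Au Du; have u : block_mx A B 0 D \in unitmx by rewrite unitmx_ublock Au.
rewrite -[LHS]mul1mx; apply: (canLR (mulmxK u)).
rewrite [RHS]mulmx_block !(mulmx0, mul0mx, add0r, addr0) !mulVmx //.
by rewrite mulNmx -!mulmxA mulVmx // mulmx1 subrr -scalar_mx_block.
Qed.

(** Sums, products and inverses preserve block triangular form; only the corner W depends on Z. *)
Lemma ev_blk m n (X : 'I_g -> 'M[k]_m) (Z : 'I_g -> 'M[k]_(m, n))
    (T : 'I_g -> 'M[k]_n) r : defined X r -> defined T r ->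
  defined (blk X Z T) r /\
  exists W, ev (blk X Z T) r = block_mx (ev X r) W 0 (ev T r).
Proof.
elim: r => [a|i|r1 IH1 r2 IH2|r1 IH1 r2 IH2|r1 IH1] /=.
- by split=> //; exists 0; exact: scalar_mx_block.
- by split=> //; exists (Z i).
- move=> /andP[/IH1{}IH1 /IH2{}IH2] /andP[/IH1[-> [W1 ->]] /IH2[-> [W2 ->]]].
  by split=> //; exists (W1 + W2); rewrite add_block_mx addr0.
- move=> /andP[/IH1{}IH1 /IH2{}IH2] /andP[/IH1[-> [W1 ->]] /IH2[-> [W2 ->]]].
  split=> //; exists (ev X r1 *m W2 + W1 *m ev T r2).
  by rewrite mulmx_block !(mulmx0, mul0mx, add0r, addr0).
- move=> /andP[/IH1{}IH1 uX] /andP[/IH1[-> [W1 ->]] uT].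
  by rewrite unitmx_ublock uX uT invmx_ublock //; split=> //; eexists.
Qed.

Lemma defined0 (X : 'I_g -> 'M[k]_0) r : defined X r.
Proof.
by elim: r => //= [r1 -> r2 ->|r1 -> r2 ->|r1 ->] //; rewrite unitmxE det_mx00 unitr1.
Qed.

Lemma defined_pow r m (T : 'I_g -> 'M[k]_m) j : defined T r ->
  exists T' : 'I_g -> 'M[k]_(j * m), defined T' r.
Proof.
move=> rT; elim: j => [|j [T' rT']]; first by exists (fun=> 0); exact: defined0.
by exists (blk T (fun=> 0) T'); have [] := ev_blk (fun=> 0) rT rT'.
Qed.

(** Enlarges a common domain point so that it can be joined by a line to a point of another size.
    The equation to be proved survives, because the value at T is a diagonal block. *)
Lemma common_pow r s m (T : 'I_g -> 'M[k]_m) j : defined T r -> defined T s ->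
  exists T' : 'I_g -> 'M[k]_(j.+1 * m), [/\ defined T' r, defined T' s &
    ev T' r = ev T' s -> ev T r = ev T s].
Proof.
move=> rT sT.
have [T' rT' sT'] : exists2 T' : 'I_g -> 'M[k]_(j * m), defined T' r & defined T' s.
  elim: j => [|j [T' rT' sT']]; first by exists (fun=> 0); exact: defined0.
  exists (blk T (fun=> 0) T'); first by have [] := ev_blk (fun=> 0) rT rT'.
  by have [] := ev_blk (fun=> 0) sT sT'.
exists (blk T (fun=> 0) T').
have [-> [W ->]] := ev_blk (fun=> 0) rT rT'.
have [-> [W' ->]] := ev_blk (fun=> 0) sT sT'.
by split=> // /eq_block_mx[].
Qed.

Lemma ev_reg t0 n (X : k -> 'I_g -> 'M[k]_n) r :
  (forall i, regmx t0 (fun t => X t i)) -> defined (X t0) r ->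
  znear t0 (fun t => defined (X t) r) /\ regmx t0 (fun t => ev (X t) r).
Proof.
move=> HX; elim: r => [a|i|r1 IH1 r2 IH2|r1 IH1 r2 IH2|r1 IH1] /=.
- by split; [apply: znearT | apply: regmx_const].
- by split; [apply: znearT | apply: HX].
- move=> /andP[/IH1[n1 R1] /IH2[n2 R2]]; split; last exact: regmx_add.
  by apply: znear_mono (znear_and n1 n2) => t [-> ->].
- move=> /andP[/IH1[n1 R1] /IH2[n2 R2]]; split; last exact: regmx_mul.
  by apply: znear_mono (znear_and n1 n2) => t [-> ->].
- move=> /andP[/IH1[n1 R1] u]; split; last exact: regmx_inv.
  by apply: znear_mono (znear_and n1 (regmx_unit R1 u)) => t [-> ->].
Qed.

Definition scaled n (X : 'I_g -> 'M[k]_n) (t : k) : 'I_g -> 'M[k]_n := fun i => t *: X i.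

Lemma scaled_reg t0 n (X : 'I_g -> 'M[k]_n) i : regmx t0 (fun t => scaled X t i).
Proof. by apply: regmx_scale; [exact: reg_id | exact: regmx_const]. Qed.

Lemma scaled1 n (X : 'I_g -> 'M[k]_n) : scaled X 1 = X.
Proof. by apply/funext => i; rewrite /scaled scale1r. Qed.

Lemma scaled0 n (X : 'I_g -> 'M[k]_n) : scaled X 0 = fun=> 0.
Proof. by apply/funext => i; rewrite /scaled scale0r. Qed.

(** At the origin all subexpressions have scalar values independent of the size, so no inverse can
    fail at one size only. *)
Lemma ev0 r n : defined (fun _ : 'I_g => 0 : 'M[k]_1) r ->
  defined (fun _ : 'I_g => 0 : 'M[k]_n) r /\
  ev (fun _ : 'I_g => 0 : 'M[k]_n) r = (ev (fun _ : 'I_g => 0 : 'M[k]_1) r 0 0)%:M.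
Proof.
elim: r => [a|i|r1 IH1 r2 IH2|r1 IH1 r2 IH2|r1 IH1] /=.
- by rewrite !mxE eqxx mulr1n.
- by rewrite mxE raddf0.
- by move=> /andP[/IH1[-> ->] /IH2[-> ->]]; rewrite mxE raddfD.
- by move=> /andP[/IH1[-> ->] /IH2[-> ->]]; rewrite mxE big_ord1 -scalar_mxM.
- move=> /andP[/IH1[-> ->]]; set A := ev _ r1 => uA.
  have a0 : A 0 0 \is a GRing.unit by move: uA; rewrite unitmxE det_mx11.
  by rewrite unitmxE det_scalar unitrX // {2}[A]mx11_scalar !invmx_scalar mxE eqxx mulr1n.
Qed.

Hypothesis char_k : [pchar k] =i pred0.

Lemma line_reg t0 n (X T : 'I_g -> 'M[k]_n) i :
  regmx t0 (fun t => X i + t *: (T i - X i)).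
Proof.
by apply: regmx_add; [|apply: regmx_scale; [exact: reg_id|]]; apply: regmx_const.
Qed.

(* A common domain point of [r1] and [r3] and a domain point of [r2] are joined
   by a line after inflating them to the same size. *)
Lemma expr_equiv_trans r1 r2 r3 :
  expr_equiv r1 r2 -> expr_equiv r2 r3 -> expr_equiv r1 r3.
Proof.
move=> /[dup] e12 [/expr_dom_neq0 s1 /expr_dom_neq0[m [T0 rT0]] _].
move=> /[dup] e23 [_ /expr_dom_neq0 s3 _].
apply: expr_equivI => // n X0 r1X r3X.
have [X [X1 X3 backX]] := common_pow m r1X r3X; apply: backX.
have [T] := defined_pow n.+1 rT0; move: T.
rewrite mulnC => T r2T.
pose L t : 'I_g -> 'M[k]_(m.+1 * n.+1) := fun i => X i + t *: (T i - X i).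
have L0 : L 0 = X by apply/funext => i; rewrite /L scale0r addr0.
have L1 : L 1 = T by apply/funext => i; rewrite /L scale1r addrC subrK.
have regL t0 i : regmx t0 (fun t => L t i) by exact: line_reg.
have := X1; rewrite -{1}L0 => /(ev_reg (regL 0))[near1 reg1].
have := X3; rewrite -{1}L0 => /(ev_reg (regL 0))[near3 reg3].
have := r2T; rewrite -{1}L1 => /(ev_reg (regL 1))[near2 _].
rewrite -L0; apply: (regmx_eq2 char_k reg1 reg3 (znear_and near1 near3) near2).
by move=> t [d1 d3] d2; rewrite (expr_equivP e12) // (expr_equivP e23).
Qed.

End Evaluation.

(** * The pencil as an operator on matrices *)

Section SteinOperator.
Variables (k : fieldType) (g : nat).

Definition trt n (X : 'I_g -> 'M[k]_n) : 'I_g -> 'M[k]_n := fun i => (X i)^T.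

Lemma trtK n (X : 'I_g -> 'M[k]_n) : trt (trt X) = X.
Proof. by apply/funext => i; rewrite /trt trmxK. Qed.

(** Rectangular shapes are allowed for the off-diagonal blocks of coefficients and of points. *)
Definition Kop d e (F : 'I_g -> 'M[k]_(d, e)) p n (X : 'I_g -> 'M[k]_(p, n))
    (V : 'M[k]_(n, d)) : 'M[k]_(p, e) :=
  \sum_i X i *m V *m F i.

Lemma KopD d e (F : 'I_g -> 'M[k]_(d, e)) p n (X : 'I_g -> 'M[k]_(p, n)) V W :
  Kop F X (V + W) = Kop F X V + Kop F X W.
Proof. by rewrite -big_split; apply: eq_bigr => i _; rewrite mulmxDr mulmxDl. Qed.

Lemma KopZ d e (F : 'I_g -> 'M[k]_(d, e)) p n (X : 'I_g -> 'M[k]_(p, n)) a V :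
  Kop F X (a *: V) = a *: Kop F X V.
Proof. by rewrite scaler_sumr; apply: eq_bigr => i _; rewrite -scalemxAr -scalemxAl. Qed.

Lemma Kop_scaled d e (F : 'I_g -> 'M[k]_(d, e)) n (X : 'I_g -> 'M[k]_n) t V :
  Kop F (scaled X t) V = t *: Kop F X V.
Proof. by rewrite scaler_sumr; apply: eq_bigr => i _; rewrite -!scalemxAl. Qed.

Lemma KopMr d e m (F : 'I_g -> 'M[k]_(d, e)) p n (X : 'I_g -> 'M[k]_(p, n)) V (M : 'M[k]_(e, m)) :
  Kop (fun i => F i *m M) X V = Kop F X V *m M.
Proof. by rewrite mulmx_suml; apply: eq_bigr => i _; rewrite !mulmxA. Qed.

Lemma KopMl d e m (F : 'I_g -> 'M[k]_(d, e)) p n (X : 'I_g -> 'M[k]_(p, n)) V (M : 'M[k]_(m, d)) :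
  Kop F X (V *m M) = Kop (fun i => M *m F i) X V.
Proof. by apply: eq_bigr => i _; rewrite !mulmxA. Qed.

Lemma Kop_eq0 d e (F : 'I_g -> 'M[k]_(d, e)) p n (X : 'I_g -> 'M[k]_(p, n)) V :
  (forall i, F i = 0) -> Kop F X V = 0.
Proof. by move=> F0; apply: big1 => i _; rewrite F0 mulmx0. Qed.

Lemma Kop_row d1 d2 e1 e2 (A : 'I_g -> 'M[k]_(d1, e1)) (B : 'I_g -> 'M[k]_(d1, e2))
    (C : 'I_g -> 'M[k]_(d2, e1)) (D : 'I_g -> 'M[k]_(d2, e2)) p n (X : 'I_g -> 'M[k]_(p, n)) V W :
  Kop (fun i => block_mx (A i) (B i) (C i) (D i)) X (row_mx V W) =
  row_mx (Kop A X V + Kop C X W) (Kop B X V + Kop D X W).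
Proof.
transitivity (\sum_i row_mx (X i *m V *m A i + X i *m W *m C i)
                 (X i *m V *m B i + X i *m W *m D i)).
  by apply: eq_bigr => i _; rewrite mul_mx_row mul_row_block.
rewrite /Kop -!big_split /=; apply/matrixP => a b; rewrite summxE.
case: (split_ordP b) => c ->.
  by rewrite row_mxEl summxE; apply: eq_bigr => i _; rewrite row_mxEl.
by rewrite row_mxEr summxE; apply: eq_bigr => i _; rewrite row_mxEr.
Qed.

Section Fixed.
Variables (d : nat) (F : 'I_g -> 'M[k]_d).

(* After vectorisation this is the evaluation at X of the monic pencil whose
   coefficients are the transposes of the F i. *)
Definition Lop n (X : 'I_g -> 'M[k]_n) (V : 'M[k]_(n, d)) : 'M[k]_(n, d) :=
  V - Kop F X V.

Lemma Lop_at0 n (V : 'M[k]_(n, d)) : Lop (fun=> 0) V = V.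
Proof.
by rewrite /Lop /Kop big1 ?subr0 // => i _; rewrite !mul0mx.
Qed.

Definition Lmx n (X : 'I_g -> 'M[k]_n) : 'M[k]_(n * d) :=
  1%:M - \sum_i lin_mx (mulmxr (F i) \o mulmx (X i)).

Lemma mul_Lmx n (X : 'I_g -> 'M[k]_n) V : mxvec V *m Lmx X = mxvec (Lop X V).
Proof.
rewrite mulmxBr mulmx1 /Lop [RHS]linearB /=; congr (_ - _).
rewrite mulmx_sumr /Kop linear_sum; apply: eq_bigr => i _.
by rewrite mul_vec_lin.
Qed.

Definition Linv n (X : 'I_g -> 'M[k]_n) : bool := Lmx X \in unitmx.

Definition sol n (X : 'I_g -> 'M[k]_n) (U : 'M[k]_(n, d)) : 'M[k]_(n, d) :=
  vec_mx (mxvec U *m invmx (Lmx X)).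

Lemma solK n (X : 'I_g -> 'M[k]_n) U : Linv X -> Lop X (sol X U) = U.
Proof.
move=> HX; apply: (can_inj mxvecK); rewrite -mul_Lmx vec_mxK.
by rewrite -mulmxA mulVmx // mulmx1.
Qed.

Lemma LopK n (X : 'I_g -> 'M[k]_n) V : Linv X -> sol X (Lop X V) = V.
Proof. by move=> HX; rewrite /sol -mul_Lmx mulmxK // mxvecK. Qed.

Lemma Lop_inj n (X : 'I_g -> 'M[k]_n) V W : Linv X -> Lop X V = Lop X W -> V = W.
Proof. by move=> HX e; rewrite -(LopK V HX) e LopK. Qed.

Lemma Lop_eq0 n (X : 'I_g -> 'M[k]_n) V : Linv X -> Lop X V = 0 -> V = 0.
Proof.
move=> HX /(congr1 (sol X)); rewrite LopK // => ->.
by rewrite /sol linear0 mul0mx linear0.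
Qed.

Lemma Linv_inj n (X : 'I_g -> 'M[k]_n) : (forall V, Lop X V = 0 -> V = 0) -> Linv X.
Proof.
move=> H; rewrite /Linv -row_free_unit -kermx_eq0; apply/rowV0P => v /sub_kermxP.
rewrite -[v]vec_mxK mul_Lmx => /eqP; rewrite mxvec_eq0 => /eqP/H ->.
by rewrite linear0.
Qed.

Lemma LinvPn n (X : 'I_g -> 'M[k]_n) : ~~ Linv X -> exists2 V, V != 0 & Lop X V = 0.
Proof.
move=> HX; apply: contrapT => H; move/negP: HX; apply; apply: Linv_inj => V e.
by apply/eqP/negPn/negP => V0; apply: H; exists V.
Qed.

Lemma LinvNP n (X : 'I_g -> 'M[k]_n) V : V != 0 -> Lop X V = 0 -> ~~ Linv X.
Proof. by move=> V0 e; apply: contra V0 => HX; rewrite (Lop_eq0 HX e). Qed.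

Lemma Linv_surj n (X : 'I_g -> 'M[k]_n) : (forall U, exists V, Lop X V = U) -> Linv X.
Proof.
move=> H; rewrite /Linv -row_full_unit -sub1mx; apply/row_subP => i.
have [V e] := H (vec_mx (row i 1%:M)).
by rewrite -[row i _]vec_mxK -e -mul_Lmx submxMl.
Qed.

Lemma sol_reg t0 n (X : k -> 'I_g -> 'M[k]_n) (U : k -> 'M[k]_(n, d)) :
  (forall i, regmx t0 (fun t => X t i)) -> Linv (X t0) -> regmx t0 U ->
  znear t0 (fun t => Linv (X t)) /\ regmx t0 (fun t => sol (X t) (U t)).
Proof.
move=> HX L0 HU; have HL : regmx t0 (fun t => Lmx (X t)).
  apply: regmx_add; first exact: regmx_const.
  apply: regmx_opp; apply: regmx_sum => i a b.
  have h : regmx t0 (fun t => mxvec (X t i *m vec_mx (delta_mx 0 a) *m F i)).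
    apply: regmx_mxvec; apply: regmx_mul; last exact: regmx_const.
    by apply: regmx_mul => //; exact: regmx_const.
  by apply: reg_ext (h 0 b) => t; rewrite /lin_mx /lin1_mx mxE.
split; first exact: regmx_unit HL L0.
apply: regmx_vec_mx; apply: regmx_mul; last exact: regmx_inv.
exact: regmx_mxvec.
Qed.

Lemma Linv0 n : Linv (fun _ : 'I_g => 0 : 'M[k]_n).
Proof. by apply: Linv_inj => V; rewrite Lop_at0. Qed.

(** At the origin the operator is the identity. Hence the singular locus of any pencil is avoided by
    generic points of any ray. *)
Lemma Linv_scaled_near0 n (X : 'I_g -> 'M[k]_n) : znear 0 (fun t => Linv (scaled X t)).
Proof.
have L0 : Linv (scaled X 0) by rewrite scaled0 Linv0.
exact: (sol_reg (scaled_reg 0 X) L0 (regmx_const 0 (0 : 'M[k]_(n, d)))).1.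
Qed.

End Fixed.

(** Transposition exchanges the two roles: on the left, the transposes of X are the coefficients and
    those of F the point. *)
Lemma Lop_tr d (F : 'I_g -> 'M[k]_d) n (X : 'I_g -> 'M[k]_n) V :
  Lop (trt X) (trt F) V^T = (Lop F X V)^T.
Proof.
rewrite /Lop /Kop [RHS]linearB; congr (_ - _); rewrite linear_sum; apply: eq_bigr => i _ /=.
by rewrite !trmx_mul mulmxA.
Qed.

Lemma Linv_tr d (F : 'I_g -> 'M[k]_d) n (X : 'I_g -> 'M[k]_n) :
  Linv F X -> Linv (trt X) (trt F).
Proof.
move=> HX; apply: Linv_inj => V; rewrite -[V]trmxK Lop_tr => /(congr1 trmx).
by rewrite trmxK trmx0 => /(Lop_eq0 HX) ->; rewrite trmx0.
Qed.

Definition colvec n d (V : 'M[k]_(n, d)) : 'cV[k]_(d * n) :=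
  \col_l V (mxtens_unindex l).2 (mxtens_unindex l).1.

Lemma tens_colvec d n (A : 'M[k]_d) (X : 'M[k]_n) (V : 'M[k]_(n, d)) :
  (A *t X) *m colvec V = colvec (X *m V *m A^T).
Proof.
apply/colP => l; case: (mxtens_indexP l) => a b; rewrite !mxE mxtens_indexK /=.
rewrite (reindex (@mxtens_index d n)) /=; last first.
  by exists (@mxtens_unindex d n) => ? _; rewrite (mxtens_indexK, mxtens_unindexK).
transitivity (\sum_a' \sum_b' A a a' * X b b' * V b' a').
  rewrite pair_bigA; apply: eq_bigr => -[a' b'] _ /=.
  by rewrite tensmxE mxE mxtens_indexK.
apply: eq_bigr => a' _; rewrite !mxE mulr_suml; apply: eq_bigr => b' _.
by rewrite -mulrA mulrC.
Qed.

Lemma pencil_colvec d (A : 'I_g -> 'M[k]_d) n (X : 'I_g -> 'M[k]_n) V :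
  pencil_eval A X *m colvec V = colvec (Lop (trt A) X V).
Proof.
rewrite mulmxBl mulmx_suml tens_colvec mul1mx trmx1 mulmx1.
under eq_bigr do rewrite tens_colvec.
by apply/colP => l; rewrite !mxE !summxE; congr (_ - _); apply: eq_bigr => i _; rewrite mxE.
Qed.

Lemma free_locusE d (A : 'I_g -> 'M[k]_d) n (X : 'I_g -> 'M[k]_n.+1) :
  free_locus A (existT (fun n => 'I_g -> 'M[k]_n.+1) n X) <-> ~~ Linv (trt A) X.
Proof.
pose uncol (v : 'cV[k]_(d * n.+1)) : 'M[k]_(n.+1, d) :=
  \matrix_(b, a) v (mxtens_index (a, b)) 0.
have colK v : colvec (uncol v) = v.
  by apply/colP => l; rewrite !mxE -surjective_pairing mxtens_unindexK.
have unK V : uncol (colvec V) = V.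
  by apply/matrixP => i j; rewrite !mxE mxtens_indexK.
have un0 : uncol 0 = 0 by apply/matrixP => i j; rewrite !mxE.
(* [det0P] speaks of row kernels, while [colvec] produces columns; hence the transposed
   determinant. *)
rewrite /free_locus /= -det_tr; split=> [/eqP/det0P[v v0 e]|/LinvPn[V V0 e]].
  apply: (@LinvNP _ _ _ _ (uncol v^T)).
    by apply: contraNneq v0 => e0; rewrite -[v]trmxK -(colK v^T) e0 -un0 colK trmx0.
  have := congr1 trmx e; rewrite trmx_mul trmxK trmx0 -(colK v^T) pencil_colvec => e'.
  by apply: (can_inj unK); rewrite colK e'; apply/colP => l; rewrite !mxE.
apply/eqP/det0P; exists (colvec V)^T.
  apply: contraNneq V0 => /(congr1 trmx); rewrite trmxK trmx0 => e0.
  by rewrite -(unK V) e0 un0.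
by rewrite -trmx_mul pencil_colvec e; apply/rowP => l; rewrite !mxE.
Qed.

End SteinOperator.

(** * Realizations *)

Section Realizations.
Variables (k : fieldType) (g : nat).
Hypothesis char_k : [pchar k] =i pred0.
Implicit Types (r s : ncexpr k g).

(* [r] represents c^t L_A^-1 b for [F i = (A i)^T], [gam = b^T] and [del = c]. *)
Definition realizes r d (F : 'I_g -> 'M[k]_d) (gam : 'rV[k]_d) (del : 'cV[k]_d) :=
  forall n (Y : 'I_g -> 'M[k]_n), defined Y r -> Linv F Y ->
  forall (u : 'cV[k]_n) V, Lop F Y V = u *m gam -> V *m del = ev Y r *m u.

(* The extra hypotheses are free because the ray from the origin to [Y] generically
   avoids the singular loci of [E1] and [E2]. *)
Lemma realizes_dense r d (F : 'I_g -> 'M[k]_d) gam del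
    e1 (E1 : 'I_g -> 'M[k]_e1) e2 (E2 : 'I_g -> 'M[k]_e2) :
  (forall n (Y : 'I_g -> 'M[k]_n), defined Y r -> Linv F Y -> Linv E1 Y -> Linv E2 Y ->
    forall (u : 'cV[k]_n) V, Lop F Y V = u *m gam -> V *m del = ev Y r *m u) ->
  realizes r F gam del.
Proof.
move=> H n Y rY LY u V e.
have rY1 : defined (scaled Y 1) r by rewrite scaled1.
have LY1 : Linv F (scaled Y 1) by rewrite scaled1.
have [nr er] := ev_reg (scaled_reg 1 Y) rY1.
have [nL eL] := sol_reg (scaled_reg 1 Y) LY1 (regmx_const 1 (u *m gam)).
have := regmx_eq2 char_k (regmx_mul eL (regmx_const 1 del))
  (regmx_mul er (regmx_const 1 u)) (znear_and nr nL)
  (znear_and (Linv_scaled_near0 E1 Y) (Linv_scaled_near0 E2 Y)).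
rewrite !scaled1 -e LopK //; apply=> t [rt Lt] [E1t E2t].
by apply: H => //; rewrite scaled1 in LY1; rewrite solK.
Qed.

Lemma realizes_const a :
  realizes (NcConst a) (fun=> 0 : 'M_1) (1%:M : 'rV[k]_1) (a%:M : 'cV[k]_1).
Proof.
move=> n Y _ _ u V; rewrite /Lop Kop_eq0 // subr0 => -> /=.
by rewrite mulmx1 mul_scalar_mx mul_mx_scalar.
Qed.

(** The coefficients are nilpotent of size 2: the first column of V is u, the second is
    [Y i *m u]. *)
Lemma realizes_var i :
  realizes (NcVar i) (fun j => block_mx (0 : 'M_1) ((j == i)%:R%:M : 'M_1) 0 (0 : 'M_1))
    (row_mx 1%:M 0) (col_mx 0 1%:M : 'cV[k]_(1 + 1)).
Proof.
move=> n Y _ _ u V /=; rewrite -[V]hsubmxK; move: (lsubmx V) (rsubmx V) => {}V W.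
rewrite /Lop Kop_row !(@Kop_eq0 _ _ _ _ (fun=> 0)) // !add0r !addr0.
rewrite opp_row_mx add_row_mx subr0 mul_mx_row mulmx0 mulmx1 => /eq_row_mx[-> e].
rewrite mul_row_col mulmx0 mulmx1 add0r; move/eqP: e; rewrite subr_eq0 => /eqP ->.
rewrite /Kop (bigD1 i) //= eqxx mulmx1 big1 ?addr0 // => j /negPf ->.
by rewrite raddf0 mulmx0.
Qed.

Section TwoRealizations.
Variables (r1 r2 : ncexpr k g) (d1 d2 : nat).
Variables (F1 : 'I_g -> 'M[k]_d1) (gam1 : 'rV[k]_d1) (del1 : 'cV[k]_d1).
Variables (F2 : 'I_g -> 'M[k]_d2) (gam2 : 'rV[k]_d2) (del2 : 'cV[k]_d2).
Hypotheses (H1 : realizes r1 F1 gam1 del1) (H2 : realizes r2 F2 gam2 del2).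

Definition dsum : 'I_g -> 'M[k]_(d1 + d2) := fun i => block_mx (F1 i) 0 0 (F2 i).

Lemma Lop_dsum n (Y : 'I_g -> 'M[k]_n) V W :
  Lop dsum Y (row_mx V W) = row_mx (Lop F1 Y V) (Lop F2 Y W).
Proof.
rewrite /Lop Kop_row !(@Kop_eq0 _ _ _ _ (fun=> 0)) // addr0 add0r.
by rewrite opp_row_mx add_row_mx.
Qed.

Lemma realizes_add :
  realizes (NcAdd r1 r2) dsum (row_mx gam1 gam2) (col_mx del1 del2).
Proof.
apply: (realizes_dense (E1 := F1) (E2 := F2)) => n Y /= /andP[d1Y d2Y] _ L1 L2 u V.
rewrite -[V]hsubmxK Lop_dsum mul_mx_row => /eq_row_mx[/(H1 d1Y L1) e1 /(H2 d2Y L2) e2].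
by rewrite mul_row_col e1 e2 mulmxDl.
Qed.

(** Series connection: the output [W *m del2] of the second system becomes the u of the first.
    Substituting W = u gam2 + [Kop F2 Y W] into [W *m del2 *m gam1] splits it into a constant part,
    put into the input row, and a linear part, put into the corner; the pencil stays monic. *)
Lemma realizes_mul :
  realizes (NcMul r1 r2) (fun i => block_mx (F1 i) 0 (F2 i *m (del2 *m gam1)) (F2 i))
    (row_mx (gam2 *m (del2 *m gam1)) gam2) (col_mx del1 0).
Proof.
apply: (realizes_dense (E1 := F1) (E2 := F2)) => n Y /= /andP[d1Y d2Y] _ L1 L2 u V.
rewrite -[V]hsubmxK /Lop Kop_row KopMr !(@Kop_eq0 _ _ _ _ (fun=> 0)) // add0r.
rewrite opp_row_mx add_row_mx mul_mx_row => /eq_row_mx[e1 e2].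
have := H2 d2Y L2 e2; rewrite mul_row_col mulmx0 addr0 -mulmxA => <-.
apply: H1 => //; move/eqP: e1; rewrite opprD addrA subr_eq => /eqP.
rewrite /Lop => ->; move/eqP: e2; rewrite subr_eq => /eqP e2.
by rewrite [in RHS]e2 -mulmxA mulmxDl -!mulmxA.
Qed.

End TwoRealizations.

(** Feedback: the last column w of the solution should be r^-1 u, so V has to satisfy
    [Lop F Y V = w *m gam] and [V *m del = u]. The second equation is solved for w by dividing by a,
    which in the application is the value of r at the origin. *)
Lemma realizes_inv r d (F : 'I_g -> 'M[k]_d) gam del a :
  realizes r F gam del -> gam *m del = a%:M -> a != 0 ->
  realizes (NcInv r)
    (fun i => block_mx (F i *m (1%:M - a^-1 *: (del *m gam))) (F i *m (- a^-1 *: del)) 0 (0 : 'M_1))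
    (row_mx (a^-1 *: gam) a^-1%:M) (col_mx 0 1%:M).
Proof.
move=> H ea a0.
apply: (realizes_dense (E1 := F) (E2 := F)) => n Y /= /andP[rY uY] _ L1 _ u V.
rewrite -[V]hsubmxK; move: (lsubmx V) (rsubmx V) => {}V w.
rewrite /Lop Kop_row !KopMr !(@Kop_eq0 _ _ _ _ (fun=> 0)) // !addr0.
rewrite opp_row_mx add_row_mx mul_mx_row => /eq_row_mx[/eqP eV /eqP ew].
rewrite mul_row_col mulmx0 add0r mulmx1.
move: eV ew; rewrite !subr_eq mulmxBr mulmx1 -!scalemxAr mul_mx_scalar.
move=> /eqP eV /eqP ew; set K := Kop F Y V in eV ew.
have eVw : Lop F Y V = w *m gam.
  rewrite /Lop -/K {1}eV ew mulmxDl -!scalemxAl !mulmxA scaleNr.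
  by rewrite [K - _]addrC addrA addrK.
have := H _ _ rY L1 _ _ eVw.
have -> : V *m del = u.
  move/eqP: eVw; rewrite /Lop subr_eq -/K => /eqP ->.
  rewrite mulmxDl -mulmxA ea mul_mx_scalar ew scalerDr !scalerA mulrN divff //.
  by rewrite scale1r scaleN1r subrK.
by move=> ->; rewrite mulKmx.
Qed.

Lemma realization_exists r : defined (fun _ : 'I_g => 0 : 'M[k]_1) r ->
  exists d (F : 'I_g -> 'M[k]_d) gam del, realizes r F gam del.
Proof.
elim: r => [a|i|r1 IH1 r2 IH2|r1 IH1 r2 IH2|r IH] /=.
- by move=> _; do 4!eexists; exact: realizes_const.
- by move=> _; do 4!eexists; exact: realizes_var.
- move=> /andP[/IH1[d1 [F1 [g1 [c1 H1]]]] /IH2[d2 [F2 [g2 [c2 H2]]]]].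
  by do 4!eexists; exact: realizes_add H1 H2.
- move=> /andP[/IH1[d1 [F1 [g1 [c1 H1]]]] /IH2[d2 [F2 [g2 [c2 H2]]]]].
  by do 4!eexists; exact: realizes_mul H1 H2.
- move=> /andP[r0 u0]; have [d [F [gam [del H]]]] := IH r0.
  do 4!eexists; apply: (realizes_inv (a := ev (fun _ : 'I_g => 0 : 'M[k]_1) r 0 0) H).
    rewrite -mx11_scalar.
    by have := H _ _ r0 (Linv0 F 1) 1%:M gam; rewrite Lop_at0 mul1mx mulmx1; apply.
  by move: u0; rewrite unitmxE det_mx11 unitfE.
Qed.

End Realizations.

(** * Minimal realizations *)

Section StableSubspaces.
Variables (k : fieldType) (g : nat).
Hypothesis char_k : [pchar k] =i pred0.
Implicit Types (r s : ncexpr k g).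

(** Turns a subspace given by a predicate into a matrix: one of maximal rank with row space inside J
    must absorb all of J. *)
Lemma subspace_mx d (J : 'rV[k]_d -> Prop) :
  J 0 -> (forall a u v, J u -> J v -> J (a *: u + v)) ->
  exists M : 'M[k]_d, forall v, J v <-> (v <= M)%MS.
Proof.
move=> J0 JD; pose P m := `[< exists2 M : 'M[k]_d, forall v, (v <= M)%MS -> J v & \rank M = m >].
have exP : exists m, P m.
  exists 0%N; apply/asboolP; exists 0; last exact: mxrank0.
  by move=> v; rewrite submx0 => /eqP ->.
have leP m : P m -> (m <= d)%N by move=> /asboolP[M _ <-]; exact: rank_leq_col.
case: (ex_maxnP exP leP) => m /asboolP[M MJ rM] maxM.
exists M => v; split=> [Jv|]; last exact: MJ.
apply: contrapT => /negP vM.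
have : P (\rank (M + v)%MS).
  apply/asboolP; exists (M + v)%MS => // w /sub_addsmxP[[u1 u2] /= ->].
  rewrite [u2]mx11_scalar mul_scalar_mx addrC; apply: JD => //.
  exact/MJ/submxMl.
move/maxM; rewrite -rM leqNgt => /negP; apply.
by rewrite (ltn_leqif (mxrank_leqif_sup (addsmxSl M v))) addsmx_sub submx_refl.
Qed.

Definition stable d (F : 'I_g -> 'M[k]_d) m (M : 'M[k]_(m, d)) :=
  forall i, (M *m F i <= M)%MS.

(** Controllability of linear systems: [gam] is a cyclic row vector. The next definition is the dual
    notion, observability. *)
Definition ctrl d (F : 'I_g -> 'M[k]_d) (gam : 'rV[k]_d) :=
  forall M : 'M[k]_d, stable F M -> (gam <= M)%MS -> row_full M.

Definition obs d (F : 'I_g -> 'M[k]_d) (del : 'cV[k]_d) :=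
  forall M : 'M[k]_d, stable F M -> M *m del = 0 -> M = 0.

Lemma Lop_intertwine d e (F : 'I_g -> 'M[k]_d) (E : 'I_g -> 'M[k]_e) (B : 'M[k]_(e, d)) :
  (forall i, B *m F i = E i *m B) ->
  forall n (Y : 'I_g -> 'M[k]_n) V, Lop F Y (V *m B) = Lop E Y V *m B.
Proof.
move=> H n Y V; rewrite /Lop mulmxBl KopMl -KopMr; congr (_ - _).
by apply: eq_bigr => i _; rewrite H.
Qed.

Lemma stable_sub d (F : 'I_g -> 'M[k]_d) (M : 'M[k]_d) : stable F M ->
  exists F1 : 'I_g -> 'M[k]_(\rank M), forall i, row_base M *m F i = F1 i *m row_base M.
Proof.
move=> sM; exists (fun i => row_base M *m F i *m pinvmx (row_base M)) => i.
rewrite mulmxKpV // eq_row_base; apply: submx_trans (sM i).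
by rewrite submxMr // eq_row_base.
Qed.

(** The projection of row vectors modulo M, in coordinates: [cokermx] has the right kernel but is
    square, and [col_base] makes the map surjective. *)
Definition quo_mx d (M : 'M[k]_d) : 'M[k]_(d, \rank (cokermx M)) := col_base (cokermx M).

Lemma quo_mx_eq0 d (M : 'M[k]_d) m (v : 'M[k]_(m, d)) : (v *m quo_mx M == 0) = (v <= M)%MS.
Proof.
rewrite submxE -[in RHS](mulmx_base (cokermx M)) mulmxA.
apply/eqP/eqP => [->|]; first by rewrite mul0mx.
by rewrite -(mul0mx _ (row_base (cokermx M))) => /(row_free_inj (row_base_free _)).
Qed.

Lemma quo_mx_proj d (M : 'M[k]_d) : (1%:M - quo_mx M *m pinvmx (quo_mx M) <= M)%MS.
Proof.
by rewrite -quo_mx_eq0 mulmxBl mul1mx -mulmxA mulVpmx ?mulmx1 ?subrr // col_base_full.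
Qed.

Lemma stable_quo d (F : 'I_g -> 'M[k]_d) (M : 'M[k]_d) : stable F M ->
  exists F2 : 'I_g -> 'M[k]_(\rank (cokermx M)), forall i, F i *m quo_mx M = quo_mx M *m F2 i.
Proof.
move=> sM; exists (fun i => pinvmx (quo_mx M) *m (F i *m quo_mx M)) => i.
have : (1%:M - quo_mx M *m pinvmx (quo_mx M)) *m F i *m quo_mx M == 0.
  by rewrite quo_mx_eq0 (submx_trans _ (sM i)) // submxMr // quo_mx_proj.
by rewrite !mulmxBl mul1mx subr_eq0 !mulmxA => /eqP.
Qed.

Lemma realizes_sub r d (F : 'I_g -> 'M[k]_d) gam del e (E : 'I_g -> 'M[k]_e)
    (B : 'M[k]_(e, d)) gam1 :
  realizes r F gam del -> (forall i, B *m F i = E i *m B) -> gam = gam1 *m B ->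
  realizes r E gam1 (B *m del).
Proof.
move=> H BF eg; apply: (realizes_dense char_k (E1 := F) (E2 := F)) => n Y rY _ LY _ u V e1.
by rewrite mulmxA; apply: H => //; rewrite (Lop_intertwine BF) e1 eg mulmxA.
Qed.

(** Solutions for F project to solutions for E, and uniqueness for E identifies the projection with
    V. *)
Lemma realizes_quo r d (F : 'I_g -> 'M[k]_d) gam del e (E : 'I_g -> 'M[k]_e)
    (Q : 'M[k]_(d, e)) del2 :
  realizes r F gam del -> (forall i, F i *m Q = Q *m E i) -> del = Q *m del2 ->
  realizes r E (gam *m Q) del2.
Proof.
move=> H QF ed; apply: (realizes_dense char_k (E1 := F) (E2 := F)) => n Y rY LE LY _ u V e1.
pose W := sol F Y (u *m gam).
have -> : V = W *m Q.
  apply: (Lop_inj LE); rewrite e1 (@Lop_intertwine _ _ _ F) ?solK ?mulmxA //.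
by rewrite -mulmxA -ed; apply: H => //; rewrite solK.
Qed.

Lemma minimal_realization r d (F : 'I_g -> 'M[k]_d) gam del :
  realizes r F gam del ->
  exists e (E : 'I_g -> 'M[k]_e) gam' del', [/\ realizes r E gam' del', ctrl E gam' & obs E del'].
Proof.
elim/ltn_ind: d F gam del => d IH F gam del H.
have [c|/existsNP[M]] := pselect (ctrl F gam); last first.
  move=> /not_implyP[sM /not_implyP[gM /negP nM]].
  have [F1 HF1] := stable_sub sM.
  have [g1 eg] : exists g1, gam = g1 *m row_base M by apply/submxP; rewrite eq_row_base.
  apply: IH (realizes_sub H HF1 eg).
  by rewrite ltn_neqAle rank_leq_col andbT.
have [o|/existsNP[M]] := pselect (obs F del); last first.
  move=> /not_implyP[sM /not_implyP[gM /eqP nM]].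
  have [F2 HF2] := stable_quo sM.
  suff ed : del = quo_mx M *m (pinvmx (quo_mx M) *m del).
    apply: IH (realizes_quo H HF2 ed).
    by rewrite mxrank_coker ltn_subrL lt0n mxrank_eq0 nM (leq_trans _ (rank_leq_col M)) // lt0n mxrank_eq0.
  have /submxP[D e] := quo_mx_proj M.
  apply/eqP; rewrite mulmxA -subr_eq0 -{1}[del]mul1mx -mulmxBl e.
  by rewrite -mulmxA gM mulmx0.
by exists d, F, gam, del.
Qed.

Lemma stable_tr d (F : 'I_g -> 'M[k]_d) (M : 'M[k]_d) :
  stable (trt F) M -> stable F (kermx M^T).
Proof.
move=> sM i; apply/sub_kermxP; have /submxP[D e] := sM i.
by move/(congr1 trmx): e; rewrite !trmx_mul trmxK -mulmxA => ->; rewrite mulmxA mulmx_ker mul0mx.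
Qed.

Lemma obs_tr d (F : 'I_g -> 'M[k]_d) (del : 'cV[k]_d) : obs F del -> ctrl (trt F) del^T.
Proof.
move=> H M sM /submxP[D /(congr1 trmx)]; rewrite trmxK trmx_mul => e.
have K0 : kermx M^T *m del = 0 by rewrite e mulmxA mulmx_ker mul0mx.
by move/eqP: (H _ (stable_tr sM) K0); rewrite kermx_eq0 /row_free mxrank_tr.
Qed.

End StableSubspaces.

(** * The domain of a minimal realization *)

Section DomainOfMinimalRealization.
Variables (k : fieldType) (g : nat).
Hypothesis char_k : [pchar k] =i pred0.
Implicit Types (r s : ncexpr k g).

Lemma solD d (F : 'I_g -> 'M[k]_d) n (X : 'I_g -> 'M[k]_n) U W :
  sol F X (U + W) = sol F X U + sol F X W.
Proof. by rewrite /sol linearD mulmxDl linearD. Qed.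

Lemma sol_sum d (F : 'I_g -> 'M[k]_d) n (X : 'I_g -> 'M[k]_n) (I : Type) (s : seq I) U :
  sol F X (\sum_(i <- s) U i) = \sum_(i <- s) sol F X (U i).
Proof.
elim: s => [|i s IH]; last by rewrite !big_cons solD IH.
by rewrite !big_nil /sol linear0 mul0mx linear0.
Qed.

Lemma Kop_blk d e (F : 'I_g -> 'M[k]_(d, e)) m n (X : 'I_g -> 'M[k]_m)
    (Z : 'I_g -> 'M[k]_(m, n)) (T : 'I_g -> 'M[k]_n) V W :
  Kop F (blk X Z T) (col_mx V W) = col_mx (Kop F X V + Kop F Z W) (Kop F T W).
Proof.
transitivity (\sum_i col_mx (X i *m V *m F i + Z i *m W *m F i) (T i *m W *m F i)).
  apply: eq_bigr => i _.
  by rewrite /blk mul_block_col mul0mx add0r mul_col_mx mulmxDl.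
rewrite /Kop -!big_split /=; apply/matrixP => a b; rewrite summxE.
case: (split_ordP a) => c ->.
  by rewrite col_mxEu summxE; apply: eq_bigr => i _; rewrite col_mxEu.
by rewrite col_mxEd summxE; apply: eq_bigr => i _; rewrite col_mxEd.
Qed.

Lemma Lop_blk d (F : 'I_g -> 'M[k]_d) m n (X : 'I_g -> 'M[k]_m)
    (Z : 'I_g -> 'M[k]_(m, n)) (T : 'I_g -> 'M[k]_n) V W :
  Lop F (blk X Z T) (col_mx V W) = col_mx (Lop F X V - Kop F Z W) (Lop F T W).
Proof. by rewrite /Lop Kop_blk opp_col_mx add_col_mx opprD addrA. Qed.

Lemma Linv_blk d (F : 'I_g -> 'M[k]_d) m n (X : 'I_g -> 'M[k]_m)
    (Z : 'I_g -> 'M[k]_(m, n)) (T : 'I_g -> 'M[k]_n) :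
  Linv F X -> Linv F T -> Linv F (blk X Z T).
Proof.
move=> LX LT; apply: Linv_surj => U; rewrite -[U]vsubmxK.
exists (col_mx (sol F X (usubmx U + Kop F Z (sol F T (dsubmx U)))) (sol F T (dsubmx U))).
by rewrite Lop_blk !solK // addrK.
Qed.

Lemma sol_blk d (F : 'I_g -> 'M[k]_d) m n (X : 'I_g -> 'M[k]_m)
    (Z : 'I_g -> 'M[k]_(m, n)) (T : 'I_g -> 'M[k]_n) U W :
  Linv F X -> Linv F T ->
  sol F (blk X Z T) (col_mx U W) = col_mx (sol F X (U + Kop F Z (sol F T W))) (sol F T W).
Proof.
move=> LX LT; have LB := Linv_blk Z LX LT; apply: (Lop_inj LB).
by rewrite solK // Lop_blk !solK // addrK.
Qed.

(** An off-diagonal block supported on one coordinate isolates the coefficient [F i] in [Kop]. *)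
Definition single m n i (z : 'M[k]_(m, n)) : 'I_g -> 'M[k]_(m, n) :=
  fun j => if j == i then z else 0.

Lemma Kop_single d e (F : 'I_g -> 'M[k]_(d, e)) m n i (z : 'M[k]_(m, n)) W :
  Kop F (single i z) W = z *m W *m F i.
Proof.
rewrite /Kop (bigD1 i) //= /single eqxx big1 ?addr0 // => j /negPf ->.
by rewrite !mul0mx.
Qed.

Lemma Linv_size0 d (F : 'I_g -> 'M[k]_d) (X : 'I_g -> 'M[k]_0) : Linv F X.
Proof. by apply: Linv_inj => V _; exact: flatmx0. Qed.

Definition resolvent_row r d (F : 'I_g -> 'M[k]_d) (gam : 'rV[k]_d) (y : 'rV[k]_d) :=
  exists m (T : 'I_g -> 'M[k]_m) (u : 'cV[k]_m) (x : 'rV[k]_m),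
    [/\ defined T r, Linv F T & y = x *m sol F T (u *m gam)].

(* The resolvent rows form a subspace (direct sums of points) which contains [gam]
   and is stable under [F] (block triangular points one of whose diagonal
   blocks tends to the origin). *)
Lemma resolvent_rowT r d (F : 'I_g -> 'M[k]_d) gam n (X : 'I_g -> 'M[k]_n.+1) :
  defined X r -> ctrl F gam -> forall y, resolvent_row r F gam y.
Proof.
move=> rX cF; have [|a y1 y2|M HM] := @subspace_mx k d (resolvent_row r F gam).
- exists 0%N, (fun=> 0), 0, 0; split; [exact: defined0 | exact: Linv_size0 |].
  by rewrite mul0mx.
- move=> [m1 [T1 [u1 [x1 [r1 L1 ->]]]]] [m2 [T2 [u2 [x2 [r2 L2 ->]]]]].
  exists (m1 + m2)%N, (blk T1 (fun=> 0) T2), (col_mx u1 u2), (row_mx (a *: x1) x2).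
  split; [exact: (ev_blk _ r1 r2).1 | exact: Linv_blk |].
  rewrite mul_col_mx sol_blk // mul_row_col -scalemxAl (_ : Kop _ _ _ = 0) ?addr0 //.
  by apply: big1 => i _; rewrite !mul0mx.
pose x : 'rV[k]_n.+1 := delta_mx 0 0; pose u : 'cV[k]_n.+1 := delta_mx 0 0.
have xu : x *m u = 1%:M by rewrite mul_delta_mx; apply/matrixP => i j; rewrite !ord1 !mxE.
(* At t = 0 the row x sol(u z) is z, since x u = 1. Multiplication by [cokermx M] turns membership
   in M into an equation between regular functions, which passes from generic t to t = 0. *)
have limit z : (forall t, defined (scaled X t) r -> Linv F (scaled X t) ->
    resolvent_row r F gam (x *m sol F (scaled X t) (u *m z))) -> (z <= M)%MS.
  move=> Hz; have L0 : Linv F (scaled X 0) by rewrite scaled0 Linv0.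
  have [nL rS] := sol_reg (scaled_reg 0 X) L0 (regmx_const 0 (u *m z)).
  have rX1 : defined (scaled X 1) r by rewrite scaled1.
  have [nr _] := ev_reg (scaled_reg 1 X) rX1.
  have := regmx_eq2 char_k
    (regmx_mul (regmx_mul (regmx_const 0 x) rS) (regmx_const 0 (cokermx M)))
    (regmx_const 0 0) nL nr.
  have -> : sol F (scaled X 0) (u *m z) = u *m z.
    by apply: (Lop_inj L0); rewrite solK // scaled0 Lop_at0.
  rewrite mulmxA xu mul1mx submxE => -> // t Lt rt.
  by apply/eqP; rewrite -submxE -HM; exact: Hz.
have gM : (gam <= M)%MS by apply: limit => t rt Lt; exists n.+1, (scaled X t), u, x.
suff sM : stable F M by move=> y; rewrite HM submx_full // cF.
move=> i; apply/row_subP => j; rewrite row_mul; apply: limit => t rt Lt.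
have [m [T [u1 [x1 [rT LT ->]]]]] := (HM (row j M)).2 (row_sub _ _).
(* The corner block passes the resolvent row at T, multiplied by [F i], to the resolvent at tX. *)
exists (n.+1 + m)%N, (blk (scaled X t) (single i (u *m x1)) T), (col_mx 0 u1), (row_mx x 0).
split; [exact: (ev_blk _ rt rT).1 | exact: Linv_blk |].
by rewrite mul_col_mx mul0mx sol_blk // add0r Kop_single mul_row_col mul0mx addr0 !mulmxA.
Qed.

Fixpoint rtr r : ncexpr k g :=
  match r with
  | NcConst a => NcConst a
  | NcVar i => NcVar i
  | NcAdd r1 r2 => NcAdd (rtr r1) (rtr r2)
  | NcMul r1 r2 => NcMul (rtr r2) (rtr r1)
  | NcInv r1 => NcInv (rtr r1)
  end.

Lemma ev_rtr n (X : 'I_g -> 'M[k]_n) r : ev (trt X) (rtr r) = (ev X r)^T.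
Proof.
elim: r => [a|i|r1 IH1 r2 IH2|r1 IH1 r2 IH2|r1 IH1] //=.
- by rewrite tr_scalar_mx.
- by rewrite IH1 IH2 linearD.
- by rewrite IH1 IH2 trmx_mul.
- by rewrite IH1 trmx_inv.
Qed.

Lemma defined_rtr n (X : 'I_g -> 'M[k]_n) r : defined (trt X) (rtr r) = defined X r.
Proof.
elim: r => //= [r1 -> r2 ->|r1 -> r2 ->|r1 ->] //; first by rewrite andbC.
by rewrite ev_rtr unitmx_tr.
Qed.

(** Adjunction for the trace form; unlike [Lop_tr], it keeps point and coefficients in their
    places. *)
Lemma Lop_adjoint d (F : 'I_g -> 'M[k]_d) n (X : 'I_g -> 'M[k]_n) V W :
  \tr (Lop F X V *m W^T) = \tr (V *m (Lop (trt F) (trt X) W)^T).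
Proof.
rewrite /Lop mulmxBl linearB /= [in RHS]linearB mulmxBr linearB /=; congr (_ - _).
rewrite /Kop mulmx_suml [LHS]linear_sum [(\sum_i _)^T]linear_sum mulmx_sumr [RHS]linear_sum.
apply: eq_bigr => i _ /=; by rewrite !trmx_mul !trmxK -!mulmxA mxtrace_mulC !mulmxA.
Qed.

Lemma Linv_adjoint d (F : 'I_g -> 'M[k]_d) n (X : 'I_g -> 'M[k]_n) :
  Linv F X -> Linv (trt F) (trt X).
Proof.
move=> LX; apply: Linv_inj => W eW; apply/matrixP => i j.
have := Lop_adjoint F X (sol F X (delta_mx i j)) W.
rewrite solK // eW trmx0 mulmx0 mxtrace0 -(mul_delta_mx (0 : 'I_1)) -mulmxA mxtrace_mulC.
by rewrite -rowE -colE trace_mx11 !mxE.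
Qed.

(* Dual of [resolvent_rowT], through transposition. *)
Lemma resolvent_colT r d (F : 'I_g -> 'M[k]_d) del n (X : 'I_g -> 'M[k]_n.+1) :
  defined X r -> obs F del -> forall y : 'cV[k]_d,
  exists m (T : 'I_g -> 'M[k]_m) (u : 'cV[k]_m) (x : 'rV[k]_m),
    [/\ defined T r, Linv F T & forall z V, Lop F T V = u *m z -> x *m V *m del = z *m y].
Proof.
rewrite -defined_rtr => rX /obs_tr cF y.
have [m [T [u [x [rT LT e]]]]] := resolvent_rowT rX cF y^T.
exists m, (trt T), x^T, u^T; split.
- by rewrite -defined_rtr trtK.
- by rewrite -[F]trtK; exact: Linv_adjoint.
move=> z V eV; set W := sol _ _ _ in e.
have := Lop_adjoint F (trt T) V W; rewrite trtK solK // eV trmx_mul trmxK.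
have -> : \tr (x^T *m z *m W^T) = \tr (z *m y).
  by rewrite -mulmxA mxtrace_mulC -mulmxA -trmx_mul -e trmxK.
have -> : \tr (V *m (del *m u^T)) = \tr (u^T *m V *m del).
  by rewrite mulmxA mxtrace_mulC mulmxA.
by rewrite !trace_mx11 => e11; rewrite [LHS]mx11_scalar -e11 -mx11_scalar.
Qed.

End DomainOfMinimalRealization.

(** * Absence of poles at a domain point *)

Section DomainOfMinimalRealization.
Variables (k : fieldType) (g : nat).
Hypothesis char_k : [pchar k] =i pred0.
Implicit Types (r s : ncexpr k g).

Lemma blk_reg t0 m n (X : k -> 'I_g -> 'M[k]_m) (Z : k -> 'I_g -> 'M[k]_(m, n))
    (T : k -> 'I_g -> 'M[k]_n) i :
  (forall i, regmx t0 (fun t => X t i)) -> (forall i, regmx t0 (fun t => Z t i)) ->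
  (forall i, regmx t0 (fun t => T t i)) ->
  regmx t0 (fun t => blk (X t) (Z t) (T t) i).
Proof. by move=> HX HZ HT; apply: regmx_block => //; exact: regmx_const. Qed.

(* [r] is defined at the block triangular point with diagonal blocks T2, X, T1,
   and the corner of its value there involves the resolvent at [X] sandwiched
   between arbitrary rows and columns. *)
Lemma sandwich_ext r d (F : 'I_g -> 'M[k]_d) gam del n (X : 'I_g -> 'M[k]_n.+1) :
  realizes r F gam del -> ctrl F gam -> obs F del -> defined X r ->
  forall (x : 'rV_n.+1) (u : 'cV_n.+1) (y : 'rV_d) (z : 'cV_d) i j,
  ext 1 (fun t => x *m (sol F (scaled X t) (u *m y *m F i) *m F j) *m z).
Proof.
move=> H cF oF rX x u y z i j.
have [m1 [T1 [u1 [x1 [r1 L1 e1]]]]] := resolvent_rowT char_k rX cF y.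
have [m2 [T2 [u2 [x2 [r2 L2 e2]]]]] := resolvent_colT char_k rX oF z.
(* The upper off-diagonal block brings out [F j] and the lower one [F i]; the row W and the column U
   below select the corner. *)
pose Y t := blk T2 (fun l => row_mx (single j (u2 *m x) l) (0 : 'M_(m2, m1)))
                (blk (scaled X t) (single i (u *m x1)) T1).
have regY t0 l : regmx t0 (fun t => Y t l).
  apply: blk_reg => l'; try exact: regmx_const.
  by apply: blk_reg => l''; [exact: scaled_reg | exact: regmx_const ..].
pose U : 'cV[k]_(m2 + (n.+1 + m1)) := col_mx 0 (col_mx 0 u1).
pose W : 'rV[k]_(m2 + (n.+1 + m1)) := row_mx x2 0.
(* Definedness at [Y 1] needs nothing of the pencil at X; it makes the corner of the value of r
   regular at t = 1, and this is the required extension. *)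
have rY1 : defined (Y 1) r.
  apply: (ev_blk _ r2 _).1; apply: (ev_blk _ _ r1).1; by rewrite scaled1.
have [near1 rev] := ev_reg (regY 1) rY1.
exists (fun t => W *m ev (Y t) r *m U).
  by apply: regmx_mul; [apply: regmx_mul => //|]; exact: regmx_const.
have near0 := Linv_scaled_near0 F X.
apply: zgen_mono (zgen_and char_k (znear_zgen near1) (znear_zgen near0)) => t [rYt Lt].
have LB := Linv_blk (single i (u *m x1)) Lt L1.
have LY : Linv F (Y t) by apply: Linv_blk.
have := H _ _ rYt LY U (sol F (Y t) (U *m gam)); rewrite solK // => /(_ erefl) eY.
rewrite -!mulmxA -eY /Y !mul_col_mx !mul0mx !sol_blk // !add0r.
rewrite Kop_single -mulmxA -!(mulmxA u) (mulmxA x1) -e1 mul_col_mx.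
rewrite mul_row_col mul0mx addr0; set V := sol F (scaled X t) _.
pose VV := sol F T2 (u2 *m (x *m V *m F j)).
have eVV : x2 *m VV *m del = x *m V *m F j *m z by apply: e2; rewrite solK.
rewrite !mulmxA -eVV; congr (x2 *m sol _ _ _ *m _).
rewrite /Kop (bigD1 j) //= big1 => [|l lj].
  by rewrite /single eqxx mul_row_col mul0mx !addr0 !mulmxA.
by rewrite /single (negPf lj) mul_row_col !mul0mx addr0 mul0mx.
Qed.

(** Linear extension of the rank-one case: the inner [Kop] supplies the factor [F i], the outer one
    [F j]. *)
Lemma ext_sandwich_all r d (F : 'I_g -> 'M[k]_d) gam del n (X : 'I_g -> 'M[k]_n.+1) :
  realizes r F gam del -> ctrl F gam -> obs F del -> defined X r ->
  forall U, ext 1 (fun t => Kop F X (sol F (scaled X t) (Kop F X U))).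
Proof.
move=> H cF oF rX U.
have step1 i j (U1 : 'M_(n.+1, d)) : ext 1 (fun t => sol F (scaled X t) (U1 *m F i) *m F j).
  apply: (ext_entries char_k) => x z.
  have := ext_sum char_k (index_enum 'I_n.+1) (fun a =>
    sandwich_ext H cF oF rX x (delta_mx a 0) (row a U1) z i j).
  move/(ext_zgen char_k); apply; exists 1; apply: znearT => t.
  rewrite -mulmx_suml -mulmx_sumr; congr (_ *m _ *m _).
  rewrite -mulmx_suml -sol_sum -mulmx_suml; congr (sol _ _ (_ *m _) *m _).
  apply/matrixP => b c; rewrite summxE (bigD1 b) //= big1 => [|a ab].
    by rewrite mxE big_ord1 !mxE !eqxx mul1r addr0.
  by rewrite mxE big_ord1 !mxE eq_sym (negPf ab) mul0r.
apply: (ext_zgen char_k) (ext_sum char_k (index_enum 'I_g) (fun j =>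
  ext_sum char_k (index_enum 'I_g) (fun i => ext_mul (X j) (1%:M) (step1 i j (X i *m U))))) _.
exists 1; apply: znearT => t; rewrite /Kop; apply: eq_bigr => j _.
by rewrite sol_sum mulmx_sumr mulmx_suml; apply: eq_bigr => i _; rewrite mulmx1 mulmxA.
Qed.

(* L_tX^-1 = 1 + t K + t^2 K L_tX^-1 K with K = Kop F X, which has no pole at t = 1. *)
Lemma defined_Linv r d (F : 'I_g -> 'M[k]_d) gam del n (X : 'I_g -> 'M[k]_n) :
  realizes r F gam del -> ctrl F gam -> obs F del -> defined X r -> Linv F X.
Proof.
case: n X => [|n] X H cF oF rX; first exact: Linv_size0.
apply: Linv_surj => U.
have [G rG GE] := ext_sandwich_all H cF oF rX U.
(* The expansion of the resolvent with its last term replaced by the pole-free G; its value at t = 1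
   is the preimage of U. *)
pose S t := U + t *: (Kop F X U + t *: G t).
have rS : regmx 1 S.
  apply: regmx_add; first exact: regmx_const.
  apply: regmx_scale; first exact: reg_id.
  apply: regmx_add; first exact: regmx_const.
  by apply: regmx_scale; first exact: reg_id.
exists (S 1); rewrite -[X in Lop F X _]scaled1.
have rL : regmx 1 (fun t => Lop F (scaled X t) (S t)).
  apply: regmx_add => //; apply: regmx_opp; apply: regmx_sum => i.
  apply: regmx_mul; last exact: regmx_const.
  by apply: regmx_mul => //; exact: scaled_reg.
have [t1 Ht1] := zgen_and char_k GE (znear_zgen (Linv_scaled_near0 F X)).
apply: (regmx_eq (t1 := t1) char_k rL (regmx_const 1 U)).
apply: znear_mono Ht1 => t [eG Lt].
suff -> : S t = sol F (scaled X t) U by rewrite solK.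
have comm W : Kop F X (sol F (scaled X t) W) = sol F (scaled X t) (Kop F X W).
  apply: (Lop_inj Lt); rewrite solK // -[in RHS](solK W Lt).
  by rewrite /Lop !Kop_scaled KopD -!scaleNr KopZ.
have fix_ W : sol F (scaled X t) W = W + t *: Kop F X (sol F (scaled X t) W).
  have /eqP := solK W Lt; rewrite /Lop subr_eq Kop_scaled => /eqP e.
  exact: e.
by rewrite /S -eG [RHS]fix_ (comm U) [in RHS]fix_.
Qed.

End DomainOfMinimalRealization.

(** * Expressions for the inverse of a pencil *)

Section Solving.
Variables (k : fieldType) (g : nat).
Implicit Types (r s : ncexpr k g).

Lemma defined_sum n (Y : 'I_g -> 'M[k]_n) (I : Type) (s : seq I) (f : I -> ncexpr k g) :
  defined Y (\big[@NcAdd k g/NcConst 0]_(j <- s) f j) = all (fun j => defined Y (f j)) s.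
Proof. by elim: s => [|i s IH]; rewrite ?big_nil // big_cons /= IH. Qed.

Lemma defined_sumP n (Y : 'I_g -> 'M[k]_n) m (f : 'I_m -> ncexpr k g) :
  defined Y (\big[@NcAdd k g/NcConst 0]_(j < m) f j) <-> forall j, defined Y (f j).
Proof.
rewrite defined_sum; split=> [/allP H j|H]; first by apply: H; rewrite mem_index_enum.
by apply/allP => j _; apply: H.
Qed.

Lemma ev_sum n (Y : 'I_g -> 'M[k]_n) (I : Type) (s : seq I) (f : I -> ncexpr k g) :
  ev Y (\big[@NcAdd k g/NcConst 0]_(j <- s) f j) = \sum_(j <- s) ev Y (f j).
Proof. by elim: s => [|i s IH]; rewrite ?big_nil ?big_cons /= ?IH // raddf0. Qed.

Lemma defined_mulmx n (Y : 'I_g -> 'M[k]_n) m p q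
    (M : 'M[ncexpr k g]_(m, p)) (N : 'M[ncexpr k g]_(p, q)) i j :
  defined Y (ncmulmx M N i j) <->
  (forall l, defined Y (M i l)) /\ (forall l, defined Y (N l j)).
Proof.
rewrite mxE defined_sumP /=; split=> [H|[H1 H2] l]; last by rewrite H1 H2.
by split=> l; have /andP[] := H l.
Qed.

Lemma ev_mulmx n (Y : 'I_g -> 'M[k]_n) m p q
    (M : 'M[ncexpr k g]_(m, p)) (N : 'M[ncexpr k g]_(p, q)) i j :
  ev Y (ncmulmx M N i j) = \sum_l ev Y (M i l) *m ev Y (N l j).
Proof. by rewrite mxE ev_sum. Qed.

Definition total r := forall n (Y : 'I_g -> 'M[k]_n), defined Y r.

(** Matrices of expressions act through the columns of V, so that products compose and [pencil_mx A]
    acts as [Lop (trt A)]. *)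
Definition mxop n (Y : 'I_g -> 'M[k]_n) d e (P : 'M[ncexpr k g]_(e, d)) (V : 'M[k]_(n, d)) :
    'M[k]_(n, e) :=
  \matrix_(i, a) (\sum_b ev Y (P a b) *m col b V) i 0.

Lemma col_mxop n (Y : 'I_g -> 'M[k]_n) d e (P : 'M[ncexpr k g]_(e, d)) V a :
  col a (mxop Y P V) = \sum_b ev Y (P a b) *m col b V.
Proof. by apply/colP => i; rewrite !mxE. Qed.

Lemma mxop_mul n (Y : 'I_g -> 'M[k]_n) d e f (P : 'M[ncexpr k g]_(f, e))
    (Q : 'M[ncexpr k g]_(e, d)) V :
  mxop Y (ncmulmx P Q) V = mxop Y P (mxop Y Q V).
Proof.
apply/matrixP => i a; rewrite !mxE; congr (fun_of_matrix _ i 0).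
under [RHS]eq_bigr do rewrite col_mxop mulmx_sumr.
rewrite exchange_big; apply: eq_bigr => b _; rewrite ev_mulmx mulmx_suml.
by apply: eq_bigr => c _; rewrite mulmxA.
Qed.

Lemma mxop_const n (Y : 'I_g -> 'M[k]_n) d e (C : 'M[k]_(e, d)) V :
  mxop Y (constmx g C) V = V *m C^T.
Proof.
apply/matrixP => i a; rewrite mxE summxE [RHS]mxE; apply: eq_bigr => b _.
by rewrite [constmx g C a b]mxE /= mul_scalar_mx !mxE mulrC.
Qed.

Lemma mxop11 n (Y : 'I_g -> 'M[k]_n) (P : 'M[ncexpr k g]_1) u :
  mxop Y P u = ev Y (P 0 0) *m u.
Proof.
apply/matrixP => i j; rewrite mxE big_ord1 ord1; congr ((_ *m _) i 0).
by apply/colP => l; rewrite mxE.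
Qed.

Lemma mxop_inj n (Y : 'I_g -> 'M[k]_n) d e (P : 'M[ncexpr k g]_(e, d)) a b (v : 'cV[k]_n) :
  col a (mxop Y P (v *m delta_mx 0 b)) = ev Y (P a b) *m v.
Proof.
rewrite col_mxop (bigD1 b) //= big1 => [|c cb].
  rewrite addr0; congr (_ *m _); apply/colP => i.
  by rewrite !mxE big_ord1 !mxE !eqxx mulr1.
rewrite (_ : col c _ = 0) ?mulmx0 //; apply/colP => i.
by rewrite !mxE big_ord1 !mxE eqxx (negPf cb) mulr0.
Qed.

Lemma pencil_total d (A : 'I_g -> 'M[k]_d) a b : total (pencil_mx A a b).
Proof. by move=> n Y; rewrite mxE /= defined_sumP. Qed.

Lemma ev_pencil d (A : 'I_g -> 'M[k]_d) n (Y : 'I_g -> 'M[k]_n) a b :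
  ev Y (pencil_mx A a b) = ((a == b)%:R)%:M - \sum_i A i a b *: Y i.
Proof.
rewrite mxE /= ev_sum mxE; congr (_ + _); rewrite -sumrN; apply: eq_bigr => i _ /=.
by rewrite mul_scalar_mx scaleNr.
Qed.

Lemma mxop_pencil d (A : 'I_g -> 'M[k]_d) n (Y : 'I_g -> 'M[k]_n) V :
  mxop Y (pencil_mx A) V = Lop (trt A) Y V.
Proof.
apply/matrixP => i a; rewrite mxE summxE.
under eq_bigr do rewrite ev_pencil mulmxBl mul_scalar_mx mxE.
rewrite big_split /= [in RHS]mxE; congr (_ + _).
  rewrite (bigD1 a) //= big1 => [|b ba]; first by rewrite eqxx scale1r mxE addr0.
  by rewrite eq_sym (negPf ba) scale0r mxE.
rewrite [RHS]mxE summxE -sumrN.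
under eq_bigr do rewrite mxE mulmx_suml summxE -sumrN.
rewrite exchange_big; apply: eq_bigr => l _ /=; rewrite mxE -sumrN; apply: eq_bigr => b _.
rewrite -scalemxAl mxE !mxE mulrC; congr (- (_ * _)).
by apply: eq_bigr => c _; rewrite mxE.
Qed.

(** At X the Schur complement of an identity matrix is again an identity matrix, so the induction
    continues. At another Y, definedness of v makes the pivots invertible, which forces every
    solution w. *)
Lemma gauss d (Q : 'M[ncexpr k g]_d) (B : 'cV[ncexpr k g]_d) n (X : 'I_g -> 'M[k]_n) :
  (forall a b, defined X (Q a b)) -> (forall a, defined X (B a 0)) ->
  (forall a b, ev X (Q a b) = ((a == b)%:R)%:M) ->
  exists v : 'cV[ncexpr k g]_d, (forall a, defined X (v a 0)) /\
    forall m (Y : 'I_g -> 'M[k]_m), (forall a b, defined Y (Q a b)) ->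
      (forall a, defined Y (B a 0)) -> (forall a, defined Y (v a 0)) ->
    forall (u : 'cV[k]_m) (w : 'I_d -> 'cV[k]_m),
      (forall a, \sum_b ev Y (Q a b) *m w b = ev Y (B a 0) *m u) ->
      forall a, w a = ev Y (v a 0) *m u.
Proof.
elim: d Q B => [|d IH] Q B dQ dB eQ.
  by exists B; split=> // m Y _ _ _ u w _ [].
pose sub r s := NcAdd r (NcMul (NcConst (-1)) s).
have ev_subr m (Y : 'I_g -> 'M[k]_m) r s : ev Y (sub r s) = ev Y r - ev Y s.
  by rewrite /= mul_scalar_mx scaleN1r.
pose piv := NcInv (Q 0 0).
pose Q' : 'M[ncexpr k g]_d := \matrix_(i, j)
  sub (Q (lift 0 i) (lift 0 j)) (NcMul (Q (lift 0 i) 0) (NcMul piv (Q 0 (lift 0 j)))).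
pose B' : 'cV[ncexpr k g]_d := \col_i
  sub (B (lift 0 i) 0) (NcMul (Q (lift 0 i) 0) (NcMul piv (B 0 0))).
have pivX : defined X piv by rewrite /= dQ eQ eqxx unitmx1.
have dQ' a b : defined X (Q' a b) by rewrite mxE /= !dQ eQ eqxx unitmx1.
have dB' a : defined X (B' a 0) by rewrite mxE /= !dQ !dB eQ eqxx unitmx1.
have eQ' a b : ev X (Q' a b) = ((a == b)%:R)%:M.
  by rewrite mxE ev_subr /= !eQ -[lift 0 a == 0]/false raddf0 mul0mx subr0 (inj_eq lift_inj).
have [v [dv Hv]] := IH Q' B' dQ' dB' eQ'.
(* Back substitution; since [v0] contains the pivot, its definedness at Y makes the pivot invertible
   there. *)
pose v0 := NcMul piv (sub (B 0 0)
  (\big[@NcAdd k g/NcConst 0]_(j < d) NcMul (Q 0 (lift 0 j)) (v j 0))).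
exists (\col_a if unlift 0 a is Some i then v i 0 else v0); split.
  move=> a; rewrite mxE; case: unliftP => [i _|_] //.
  rewrite /= dB dQ eQ eqxx unitmx1 /=; apply/defined_sumP => j /=.
  by rewrite dQ dv.
move=> m Y dQY dBY dvY u w Hw.
have v0Y : defined Y v0 by have := dvY 0; rewrite mxE unlift_none.
have vY i : defined Y (v i 0) by have := dvY (lift 0 i); rewrite mxE liftK.
have pY : defined Y piv by case/andP: v0Y.
have pu : ev Y (Q 0 0) \in unitmx by case/andP: pY.
have w0 : w 0 = ev Y piv *m (ev Y (B 0 0) *m u -
    \sum_j ev Y (Q 0 (lift 0 j)) *m w (lift 0 j)).
  by rewrite -Hw big_ord_recl addrK /= mulKmx.
have wv i : w (lift 0 i) = ev Y (v i 0) *m u.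
  apply: (Hv m Y _ _ vY u (fun i => w (lift 0 i))) => [a b|a|a].
  - by rewrite mxE /= !dQY pu.
  - by rewrite mxE /= !dQY !dBY pu.
  under eq_bigr do rewrite mxE ev_subr mulmxBl.
  rewrite mxE ev_subr mulmxBl -Hw big_ord_recl w0 sumrB /= mulmxBr -!mulmxA mulmxBr.
  have -> : \sum_j (ev Y (Q (lift 0 a) 0) *m (invmx (ev Y (Q 0 0)) *m
        ev Y (Q 0 (lift 0 j)))) *m w (lift 0 j) =
      ev Y (Q (lift 0 a) 0) *m (invmx (ev Y (Q 0 0)) *m
        \sum_j ev Y (Q 0 (lift 0 j)) *m w (lift 0 j)).
    by rewrite !mulmx_sumr; apply: eq_bigr => j _; rewrite !mulmxA.
  by rewrite [RHS]addrAC [X in _ = X + _]addrAC subrr add0r addrC.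
move=> a; rewrite mxE; case: unliftP => [i ->|->] //.
rewrite w0 [in RHS]/= -mulmxA; congr (_ *m _); rewrite mulmxDl mul_scalar_mx scaleN1r mulNmx.
congr (_ - _); rewrite ev_sum mulmx_suml; apply: eq_bigr => j _ /=.
by rewrite wv mulmxA.
Qed.

Lemma mul_horner_mxMXaddC N (L : 'M[k]_N.+1) p c (w : 'rV_N.+1) :
  w *m horner_mx L (p * 'X + c%:P) = w *m horner_mx L p *m L + c *: w.
Proof.
by rewrite rmorphD rmorphM /= horner_mx_X horner_mx_C mulmxDr mulmxA mul_mx_scalar.
Qed.

(** A polynomial in the large matrix [Lmx] is the action of a small matrix of nc polynomials, namely
    the same polynomial in [pencil_mx A]. The type annotation shows the size as a successor, as
    [horner_mx] requires. *)
Lemma horner_op d (A : 'I_g -> 'M[k]_d.+1) n (X : 'I_g -> 'M[k]_n.+1) (p : {poly k}) :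
  exists P : 'M[ncexpr k g]_d.+1, (forall a b, total (P a b)) /\
  forall V, mxvec (mxop X P V) =
    mxvec V *m (horner_mx (Lmx (trt A) X : 'M_((d + n * d.+1).+1)) p : 'M_(n.+1 * d.+1)).
Proof.
elim/poly_ind: p => [|p c [P [tP HP]]].
  exists (const_mx (NcConst 0)); split=> [a b|V]; first by rewrite mxE.
  rewrite rmorph0 mulmx0; apply/eqP; rewrite mxvec_eq0; apply/eqP/matrixP => i a.
  by rewrite !mxE big1 ?mxE // => b _; rewrite mxE /= raddf0 mul0mx.
exists (\matrix_(a, b) NcAdd (ncmulmx (pencil_mx A) P a b) (NcConst (c *+ (a == b)))).
split=> [a b|V] ; first by move=> m Y; rewrite mxE /= andbT; apply/defined_mulmx; split=> l;
  [exact: pencil_total | exact: tP].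
have -> : mxop X (\matrix_(a, b) NcAdd (ncmulmx (pencil_mx A) P a b) (NcConst (c *+ (a == b)))) V
    = Lop (trt A) X (mxop X P V) + c *: V.
  rewrite -mxop_pencil -mxop_mul; apply/matrixP => i a.
  rewrite [LHS]mxE [RHS]mxE [X in _ = X + _]mxE.
  under eq_bigr do rewrite mxE /= mulmxDl mul_scalar_mx.
  rewrite big_split [LHS]mxE; congr (_ + _).
  rewrite (bigD1 a) //= eqxx big1 => [|b ba]; first by rewrite addr0 !mxE.
  by rewrite eq_sym (negPf ba) scale0r.
by rewrite linearD /= -mul_Lmx HP linearZ; exact/esym/mul_horner_mxMXaddC.
Qed.

(** The constant term of the characteristic polynomial is the determinant up to sign, so the
    Cayley-Hamilton relation can be solved for the inverse. *)
Lemma inv_horner_mx N (L : 'M[k]_N.+1) : L \in unitmx ->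
  exists q, horner_mx L q *m L = 1%:M.
Proof.
move=> uL; pose c := char_poly L; pose c0 := c`_0.
have c0n : c0 != 0.
  rewrite /c0 /c char_poly_det mulf_neq0 ?signr_eq0 //.
  by rewrite -unitfE -unitmxE.
have [q eq_c] : exists q, c = q * 'X + c0%:P.
  exists (drop_poly 1 c); rewrite -{1}(poly_take_drop 1 c) addrC expr1; congr (_ + _).
  by apply/polyP => i; rewrite coef_take_poly coefC; case: i.
exists (- c0^-1 *: q).
have CH : horner_mx L (q * 'X + c0%:P) = 0 by rewrite -eq_c Cayley_Hamilton.
move: CH; rewrite rmorphD rmorphM /= horner_mx_X horner_mx_C => /eqP.
rewrite addr_eq0 => /eqP e; rewrite horner_mxZ -scalemxAl [_ *m _]e.
by rewrite scalerN scaleNr opprK scale_scalar_mx mulVf.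
Qed.

(* By Cayley-Hamilton the inverse of the pencil at [X] is a polynomial in its value. *)
Lemma left_inverse_mx d (A : 'I_g -> 'M[k]_d) n (X : 'I_g -> 'M[k]_n) :
  Linv (trt A) X ->
  exists P : 'M[ncexpr k g]_d, (forall a b, total (P a b)) /\
  forall a b, ev X (ncmulmx P (pencil_mx A) a b) = ((a == b)%:R)%:M.
Proof.
case: d A => [|d] A; first by exists (const_mx (NcConst 0)); split=> -[].
case: n X => [|n] X.
  by exists (const_mx (NcConst 0)); split=> a b; [rewrite mxE | rewrite [LHS]flatmx0 [RHS]flatmx0].
move=> LX; have [q eq_q] := @inv_horner_mx (d + n * d.+1) (Lmx (trt A) X) LX.
have [P [tP HP]] := horner_op A X q.
exists P; split=> // a b.
have inv V : mxop X P (mxop X (pencil_mx A) V) = V.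
  apply: (can_inj mxvecK); rewrite HP mxop_pencil -mul_Lmx -mulmxA.
  by rewrite (mulmx1C eq_q) mulmx1.
have eqv (v : 'cV[k]_n.+1) : ev X (ncmulmx P (pencil_mx A) a b) *m v = (a == b)%:R *: v.
  rewrite -mxop_inj mxop_mul inv; apply/colP => i.
  by rewrite !mxE big_ord1 !mxE eqxx /= mulrC eq_sym.
apply/matrixP => i j; have /colP/(_ i) := eqv (delta_mx j 0).
by rewrite -colE mxE => ->; rewrite !mxE eqxx andbT mulr_natr.
Qed.

(** The expressions v are adapted to X, but they solve the system at every Y where they are
    defined. *)
Lemma pencil_solution d (A : 'I_g -> 'M[k]_d) (gam : 'rV[k]_d) n (X : 'I_g -> 'M[k]_n) :
  Linv (trt A) X ->
  exists v : 'I_d -> ncexpr k g, (forall a, defined X (v a)) /\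
    forall m (Y : 'I_g -> 'M[k]_m), (forall a, defined Y (v a)) ->
    forall (u : 'cV[k]_m) V, Lop (trt A) Y V = u *m gam ->
    forall a, col a V = ev Y (v a) *m u.
Proof.
move=> LX; have [P [tP HP]] := left_inverse_mx LX.
pose B : 'cV[ncexpr k g]_d := constmx g gam^T.
have tB m (Y : 'I_g -> 'M[k]_m) a : defined Y (ncmulmx P B a 0).
  by apply/defined_mulmx; split=> l; [exact: tP | rewrite !mxE].
have tQ m (Y : 'I_g -> 'M[k]_m) a b : defined Y (ncmulmx P (pencil_mx A) a b).
  by apply/defined_mulmx; split=> l; [exact: tP | exact: pencil_total].
have [v [dv Hv]] := gauss (tQ _ X) (tB _ X) HP.
exists (fun a => v a 0); split=> // m Y vY u V eV a.
apply: (Hv m Y (tQ m Y) (tB m Y) vY u (fun b => col b V)) => {}a.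
rewrite -col_mxop mxop_mul mxop_pencil eV col_mxop ev_mulmx mulmx_suml.
apply: eq_bigr => b _; rewrite -mulmxA; congr (_ *m _).
rewrite !mxE /= mul_scalar_mx; apply/colP => i.
by rewrite !mxE big_ord1 mulrC.
Qed.

Lemma realizable_at d (F : 'I_g -> 'M[k]_d) gam del n (X : 'I_g -> 'M[k]_n) :
  Linv F X -> exists2 r, defined X r & realizes r F gam del.
Proof.
rewrite -[F]trtK => LX; have [v [dv Hv]] := pencil_solution gam LX.
exists (\big[@NcAdd k g/NcConst 0]_(a < d) NcMul (NcConst (del a 0)) (v a)).
  by apply/defined_sumP => a /=; exact: dv.
move=> m Y /defined_sumP vY _ u V eV; rewrite ev_sum mulmx_suml.
have {}vY a : defined Y (v a) by case/andP: (vY a).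
apply/colP => i; rewrite mxE summxE; apply: eq_bigr => a _ /=.
rewrite mul_scalar_mx -scalemxAl -(Hv _ _ vY _ _ eV) !mxE mulrC //.
Qed.

End Solving.

(** * Rational functions *)

Section RationalFunctions.
Variables (k : fieldType) (g : nat).
Hypothesis char_k : [pchar k] =i pred0.
Implicit Types (r s : ncexpr k g) (f : ncratfun k g).

Lemma mulmx_colP m n (A B : 'M[k]_(m, n)) : (forall u : 'cV_n, A *m u = B *m u) -> A = B.
Proof.
move=> H; apply/matrixP => i j; have /colP/(_ i) := H (delta_mx j 0).
by rewrite -!colE !mxE.
Qed.

Lemma realizes_equiv r s d (F : 'I_g -> 'M[k]_d) gam del :
  realizes r F gam del -> realizes s F gam del -> somewhere r -> somewhere s ->
  expr_equiv r s.
Proof.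
move=> Hr Hs r0 s0; apply: expr_equivI => // n Y rY sY.
have := rY; rewrite -{1}(scaled1 Y) => /(ev_reg (scaled_reg 1 Y))[nr er].
have := sY; rewrite -{1}(scaled1 Y) => /(ev_reg (scaled_reg 1 Y))[ns es].
have := regmx_eq2 char_k er es (znear_and nr ns) (Linv_scaled_near0 F Y).
rewrite scaled1; apply=> t [rt st] Lt; apply: mulmx_colP => u.
have e := solK (u *m gam) Lt.
by rewrite -(Hr _ _ rt Lt _ _ e) -(Hs _ _ st Lt _ _ e).
Qed.

Lemma fun_equiv f r s : representatives f r -> (representatives f s <-> expr_equiv r s).
Proof.
case: f => R [r1 _ eR] /=; rewrite eR /= => e1; split=> e2.
  exact: (expr_equiv_trans char_k (expr_equiv_sym e1) e2).
exact: (expr_equiv_trans char_k e1 e2).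
Qed.

Lemma fun_somewhere f r : representatives f r -> somewhere r.
Proof. by move=> fr; have [/expr_dom_neq0] := (fun_equiv r fr).1 fr. Qed.

Lemma fun_of_expr r : somewhere r -> exists f, representatives f r.
Proof.
move=> r0; have ex : exists2 r1, expr_dom r1 !=set0 &
    [set s | expr_equiv r s] = [set s | expr_equiv r1 s].
  by exists r => //; apply/expr_dom_neq0.
by exists (NcRatFun ex); apply: expr_equiv_refl.
Qed.

Definition freal f d (F : 'I_g -> 'M[k]_d) gam del :=
  exists2 r, representatives f r & realizes r F gam del.

Lemma freal_at f d (F : 'I_g -> 'M[k]_d) gam del n (X : 'I_g -> 'M[k]_n.+1) :
  freal f F gam del -> Linv F X ->
  exists r, [/\ representatives f r, defined X r & realizes r F gam del].
Proof.
move=> [r fr Hr] /(realizable_at gam del)[s sX Hs]; exists s; split=> //.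
by apply/(fun_equiv _ fr)/(realizes_equiv Hr Hs (fun_somewhere fr)); exists n, X.
Qed.

(** The representative known to be realized may be undefined at Y; [freal_at] supplies another one
    that is defined there. *)
Lemma freal_all f d (F : 'I_g -> 'M[k]_d) gam del s :
  freal f F gam del -> representatives f s -> realizes s F gam del.
Proof.
move=> Hf fs [|n] Y sY LY u V eV; first by rewrite [LHS]flatmx0 [RHS]flatmx0.
have [r [fr rY Hr]] := freal_at Hf LY.
by rewrite (Hr _ _ rY LY _ _ eV) (expr_equivP ((fun_equiv _ fr).1 fs)).
Qed.

Lemma domE f n (X : 'I_g -> 'M[k]_n.+1) :
  dom f (existT (fun n => 'I_g -> 'M[k]_n.+1) n X) <->
  exists2 r, representatives f r & defined X r.
Proof.
by split=> -[r fr]; [rewrite expr_domE => rX | move=> rX]; exists r => //; rewrite expr_domE.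
Qed.

Lemma dom_freal f d (F : 'I_g -> 'M[k]_d) gam del n (X : 'I_g -> 'M[k]_n.+1) :
  freal f F gam del -> ctrl F gam -> obs F del ->
  (dom f (existT (fun n => 'I_g -> 'M[k]_n.+1) n X) <-> Linv F X).
Proof.
move=> Hf cF oF; rewrite domE; split=> [[r fr rX]|LX].
  by apply: (defined_Linv char_k _ cF oF rX); apply: freal_all Hf fr.
by have [r [fr rX _]] := freal_at Hf LX; exists r.
Qed.

Lemma freal_exists d (F : 'I_g -> 'M[k]_d) gam del : exists f, freal f F gam del.
Proof.
have [r r0 Hr] := realizable_at gam del (Linv0 F 1).
have [f fr] : exists f, representatives f r by apply: fun_of_expr; exists 0%N, (fun=> 0).
by exists f, r.
Qed.

Lemma dom_origin f : dom f (origin k g) ->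
  exists d (F : 'I_g -> 'M[k]_d) gam del, [/\ freal f F gam del, ctrl F gam & obs F del].
Proof.
move=> /(@domE f 0 (fun=> 0))[r fr r0].
have [d [F [gam [del Hr]]]] := realization_exists char_k r0.
have [e [E [gam' [del' [Hr' cE oE]]]]] := minimal_realization char_k Hr.
by exists e, E, gam', del'; split=> //; exists r.
Qed.

Lemma freal_origin f d (F : 'I_g -> 'M[k]_d) gam del :
  freal f F gam del -> dom f (origin k g).
Proof.
move=> Hf; have [r [fr r0 _]] := freal_at Hf (Linv0 F 1).
by apply/(@domE f 0 (fun=> 0)); exists r.
Qed.

(** Controllability makes every row a resolvent row, and resolvent rows multiplied by [del] give
    combinations of values of the function. *)
Lemma freal_zero f d (F : 'I_g -> 'M[k]_d) gam del :
  freal f F gam del -> ctrl F gam -> representatives f (NcConst 0) -> del = 0.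
Proof.
move=> Hf cF f0; have H0 := freal_all Hf f0.
have all_rows := @resolvent_rowT k g char_k (NcConst 0) d F gam 0 (fun=> 0) isT cF.
apply/colP => i; have [m [T [u [x [_ LT e]]]]] := all_rows (delta_mx 0 i).
have := H0 _ T isT LT u _ (solK _ LT); rewrite /= raddf0 mul0mx => e0.
have : (delta_mx 0 i : 'rV_d) *m del = 0 by rewrite e -mulmxA e0 mulmx0.
by rewrite -rowE => /rowP/(_ 0); rewrite !mxE.
Qed.

Lemma zero_freal f d (F : 'I_g -> 'M[k]_d) gam del :
  freal f F gam del -> gam = 0 \/ del = 0 -> representatives f (NcConst 0).
Proof.
move=> [r fr Hr] gd0.
have Hz : realizes (NcConst 0) F gam del.
  move=> n Y _ LY u V eV /=; rewrite raddf0 mul0mx.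
  case: gd0 => e0; last by rewrite e0 mulmx0.
  have -> : V = 0 by apply: (Lop_eq0 LY); rewrite eV e0 mulmx0.
  by rewrite mul0mx.
apply/(fun_equiv _ fr)/(realizes_equiv Hr Hz (fun_somewhere fr)).
by exists 0%N, (fun=> 0).
Qed.

Section PencilInverse.
Variables (d : nat) (A : 'I_g -> 'M[k]_d).

Lemma realizes_inverse M (b c : 'cV[k]_d) : pencil_inverse A M ->
  realizes (ncmulmx (ncmulmx (constmx g c^T) M) (constmx g b) 0 0) (trt A) b^T c.
Proof.
move=> [_ inv] n Y /defined_mulmx[dM _] _ u V; rewrite -mxop_pencil => eV.
have {}dM i j : defined Y (M i j) by have /defined_mulmx[_] := dM j; apply.
have {}inv : mxop Y M (mxop Y (pencil_mx A) V) = V.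
  rewrite -mxop_mul; apply/matrixP => i a; rewrite mxE.
  have e b0 : ev Y (ncmulmx M (pencil_mx A) a b0) = ((a == b0)%:R)%:M.
    rewrite (expr_equivP (inv a b0)) //=; [by rewrite !mxE | |].
      by apply/defined_mulmx; split=> l //; exact: pencil_total.
    by rewrite !mxE.
  rewrite (bigD1 a) //= big1 => [|b0 ba]; first by rewrite e eqxx mul1mx addr0 mxE.
  by rewrite e eq_sym (negPf ba) raddf0 mul0mx.
by rewrite -mxop11 !mxop_mul !mxop_const trmxK -eV inv.
Qed.

Lemma pencil_inverse_exists :
  exists2 M, pencil_inverse A M & forall i j, defined (fun _ : 'I_g => 0 : 'M[k]_1) (M i j).
Proof.
have L0 := Linv0 (trt A) 1.
have /choice[v Hv] := fun b : 'I_d => pencil_solution (delta_mx 0 b) L0.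
pose M : 'M[ncexpr k g]_d := \matrix_(a, b) v b a.
have M0 a b : defined (fun _ : 'I_g => 0 : 'M[k]_1) (M a b) by rewrite mxE; apply: (Hv b).1.
have col_sol n (Y : 'I_g -> 'M[k]_n) j : (forall a, defined Y (M a j)) -> Linv (trt A) Y ->
    forall u a, col a (sol (trt A) Y (u *m delta_mx 0 j)) = ev Y (M a j) *m u.
  move=> dM LY u a; rewrite mxE; apply: (Hv j).2; last by rewrite solK.
  by move=> b; have := dM b; rewrite mxE.
have cE n (Y : 'I_g -> 'M[k]_n) i j : ev Y (constmx g 1%:M i j) = ((i == j :> 'I_d)%:R)%:M.
  by rewrite mxE /= mxE.
exists M => //; split=> i j; apply: expr_equivI.
- exists 0%N, (fun=> 0); apply/defined_mulmx; split=> l; [exact: pencil_total | exact: M0].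
- by exists 0%N, (fun=> 0); rewrite !mxE.
- move=> n Y /[dup] dY /defined_mulmx[_ dM] _; rewrite cE.
  have := dY; rewrite -{1}(scaled1 Y) => /(ev_reg (scaled_reg 1 Y))[nd er].
  have := regmx_eq2 char_k er (regmx_const 1 ((i == j)%:R)%:M) nd (Linv_scaled_near0 (trt A) Y).
  rewrite scaled1. apply=> t /defined_mulmx[_ dMt] Lt; apply: mulmx_colP => u.
  rewrite ev_mulmx mulmx_suml.
  under eq_bigr do rewrite -mulmxA -col_sol //.
  rewrite -col_mxop mxop_pencil solK //; apply/colP => a.
  by rewrite mul_scalar_mx !mxE big_ord1 !mxE eqxx mulrC eq_sym.
- exists 0%N, (fun=> 0); apply/defined_mulmx; split=> l; [exact: M0 | exact: pencil_total].
- by exists 0%N, (fun=> 0); rewrite !mxE.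
- move=> n Y /[dup] dY /defined_mulmx[dM _] _; rewrite cE.
  have := dY; rewrite -{1}(scaled1 Y) => /(ev_reg (scaled_reg 1 Y))[nd er].
  (* Definedness of an entry of the product concerns only row i of M, whereas [col_sol] needs whole
     columns; near the origin all entries are defined. *)
  have nearM : znear 0 (fun t => forall a b, defined (scaled Y t) (M a b)).
    apply: znear_all => a; apply: znear_all => b.
    have [d0 _] := ev0 n.+1 (M0 a b).
    by have := d0; rewrite -{1}(scaled0 Y) => /(ev_reg (scaled_reg 0 Y))[].
  have := regmx_eq2 char_k er (regmx_const 1 ((i == j)%:R)%:M) nd
    (znear_and nearM (Linv_scaled_near0 (trt A) Y)).
  rewrite scaled1; apply=> t _ [dMt Lt]; apply: mulmx_colP => u.
  rewrite -mxop_inj mxop_mul mxop_pencil; set W := u *m delta_mx 0 j.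
  rewrite col_mxop; under eq_bigr do rewrite -col_sol //.
  have -> : \sum_b col i (sol (trt A) (scaled Y t) (col b (Lop (trt A) (scaled Y t) W) *m
      delta_mx 0 b)) = col i (sol (trt A) (scaled Y t) (Lop (trt A) (scaled Y t) W)).
    rewrite -[LHS]linear_sum -sol_sum; congr (col _ (sol _ _ _)).
    set U := Lop _ _ _; apply/matrixP => a c; rewrite summxE (bigD1 c) //= big1 => [|b bc].
      by rewrite mxE big_ord1 !mxE !eqxx mulr1 addr0.
    by rewrite mxE big_ord1 !mxE [c == b]eq_sym (negPf bc) andbF mulr0.
  rewrite LopK //; apply/colP => a.
  by rewrite mul_scalar_mx !mxE big_ord1 !mxE eqxx mulrC eq_sym.
Qed.

End PencilInverse.

Lemma has_realizationE f d (A : 'I_g -> 'M[k]_d) (b c : 'cV[k]_d) :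
  has_realization f c A b <-> freal f (trt A) b^T c.
Proof.
split=> [[M inv fM]|[r fr Hr]]; first by exists (ncmulmx (ncmulmx (constmx g c^T) M) (constmx g b) 0 0) => //; exact: realizes_inverse.
have [M inv M0] := pencil_inverse_exists A; exists M => //.
apply/(fun_equiv _ fr); apply: (realizes_equiv Hr _ (fun_somewhere fr)).
  exact: realizes_inverse.
exists 0%N, (fun=> 0); apply/defined_mulmx; split=> l; last by rewrite mxE.
by apply/defined_mulmx; split=> l'; [rewrite mxE | exact: M0].
Qed.

End RationalFunctions.

(** * Irreducible tuples *)

Section IrreducibleTuples.
Variables (k : fieldType) (g : nat).
Hypothesis char_k : [pchar k] =i pred0.
Implicit Types (r s p h : ncexpr k g).

(** Simplicity of k^d as a module over a nonunital algebra; the first condition excludes d = 0 and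
    the one-dimensional module with zero action. *)
Definition irr d (F : 'I_g -> 'M[k]_d) :=
  (exists i, F i != 0) /\ forall M : 'M[k]_d, stable F M -> M = 0 \/ row_full M.

Lemma irr_tr d (F : 'I_g -> 'M[k]_d) : irr F -> irr (trt F).
Proof.
move=> [[i Fi] HF]; split; first by exists i; rewrite trmx_eq0.
move=> M /stable_tr/HF[/eqP|].
  by rewrite kermx_eq0 /row_free mxrank_tr; right.
rewrite -sub1mx => /sub_kermxP; rewrite mul1mx => /eqP.
by rewrite trmx_eq0 => /eqP; left.
Qed.

Lemma irr_ctrl d (F : 'I_g -> 'M[k]_d) gam : irr F -> gam != 0 -> ctrl F gam.
Proof.
by move=> [_ HF] g0 M /HF[->|//]; rewrite submx0 (negPf g0).
Qed.

Lemma irr_obs d (F : 'I_g -> 'M[k]_d) del : irr F -> del != 0 -> obs F del.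
Proof.
move=> [_ HF] d0 M /HF[//|fM] e; case/eqP: d0.
by rewrite -[del]mul1mx -(mulVpmx fM) -mulmxA e mulmx0.
Qed.

Lemma irr_gt0 d (F : 'I_g -> 'M[k]_d) : irr F -> (0 < d)%N.
Proof. by case: d F => // F [[i /eqP[]]]; exact: flatmx0. Qed.

(** Polynomials without constant term, whose values at A form the nonunital algebra generated by
    A. *)
Inductive pol0 : ncexpr k g -> Prop :=
| pol0_zero : pol0 (NcConst 0)
| pol0_var i : pol0 (NcVar i)
| pol0_add p q : pol0 p -> pol0 q -> pol0 (NcAdd p q)
| pol0_scale a p : pol0 p -> pol0 (NcMul (NcConst a) p)
| pol0_mul p q : pol0 p -> pol0 q -> pol0 (NcMul p q).

Lemma pol0_total p : pol0 p -> total p.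
Proof.
by elim=> // {}p q _ tp _ tq n Y /=; rewrite tp tq.
Qed.

Lemma pol0_at0 p n : pol0 p -> ev (fun _ : 'I_g => 0 : 'M[k]_n) p = 0.
Proof.
elim=> //= [|{}p q _ -> _ ->|a {}p _ ->|{}p q _ -> _ ->].
- by rewrite raddf0.
- by rewrite addr0.
- by rewrite mulmx0.
- by rewrite mulmx0.
Qed.

Lemma pol0_sum m (f : 'I_m -> ncexpr k g) :
  (forall j, pol0 (f j)) -> pol0 (\big[@NcAdd k g/NcConst 0]_(j < m) f j).
Proof.
move=> H; elim: (index_enum _) => [|i s IH]; first by rewrite big_nil; exact: pol0_zero.
by rewrite big_cons; exact: pol0_add.
Qed.

(** Without a unit the orbit of v might be 0. Then v would span a stable subspace, hence everything,
    and all [A i] would vanish. *)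
Lemma irr_cyclic d (A : 'I_g -> 'M[k]_d) (v u : 'rV[k]_d) : irr A -> v != 0 ->
  exists2 p, pol0 p & v *m ev A p = u.
Proof.
move=> [[i0 Ai0] HA] v0.
have [| |M HM] := @subspace_mx k d (fun u => exists2 p, pol0 p & v *m ev A p = u).
- by exists (NcConst 0); [exact: pol0_zero | rewrite /= raddf0 mulmx0].
- move=> a _ _ [p p0 <-] [q q0 <-]; exists (NcAdd (NcMul (NcConst a) p) q).
    by apply: pol0_add => //; exact: pol0_scale.
  by rewrite /= mulmxDr mul_scalar_mx -scalemxAr.
apply/HM; have sM : stable A M.
  move=> i; apply/row_subP => j; rewrite row_mul.
  have [p p0 <-] := (HM (row j M)).2 (row_sub _ _); apply/HM.
  by exists (NcMul p (NcVar i)); [exact/pol0_mul/pol0_var | rewrite /= mulmxA].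
have [M0|] := HA M sM; last by move=> ?; rewrite submx_full.
have vA i : v *m A i = 0.
  apply/eqP; rewrite -submx0 -M0; apply/HM; exists (NcVar i) => //; exact: pol0_var.
have sv : stable A <<v>>%MS.
  by move=> i; rewrite (submx_trans (submxMr _ (_ : <<v>> <= v)%MS)) ?genmxE // vA sub0mx.
case: (HA _ sv) => [e0|fv].
  by case/eqP: v0; apply/eqP; rewrite -submx0 -e0 genmxE.
have : (1%:M <= v)%MS by rewrite -(genmxE v) sub1mx.
move/(submxMr (A i0)); rewrite mul1mx vA => /submx0null e0.
by rewrite e0 eqxx in Ai0.
Qed.

Definition sub_ker d (A : 'I_g -> 'M[k]_d) e (C : 'I_g -> 'M[k]_e) :=
  forall p, pol0 p -> ev A p = 0 -> ev C p = 0.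

Definition sub_reg d (F : 'I_g -> 'M[k]_d) e (E : 'I_g -> 'M[k]_e) :=
  forall n (X : 'I_g -> 'M[k]_n), Linv F X -> Linv E X.

(* If p(A) = 0 while p(C) fixes a nonzero vector, let E be a minimal realization
   of (1 - p)^-1. Its domain contains A but not C, that is, the pencil of A is
   invertible at E^T while that of C is not. *)
Lemma sub_reg_ker d (A : 'I_g -> 'M[k]_d) e (C : 'I_g -> 'M[k]_e) :
  irr C -> sub_reg (trt A) (trt C) -> sub_ker A C.
Proof.
move=> iC AC p p0 pA; apply/eqP/negPn/negP => pC.
have [v v0] : exists v : 'rV_e, v *m ev C p != 0.
  by have /rowV0Pn[w /submxP[v ev] w0] := pC; exists v; rewrite -ev.
(* h carries [v *m ev C p] back to v, so q = p h fixes v at C and still vanishes at A. *)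
have [h h0 hv] := irr_cyclic v iC v0.
pose q := NcMul p h; have pq : pol0 q by apply: pol0_mul.
have tq := pol0_total pq; have q0 := pol0_at0 1 pq.
have qA : ev A q = 0 by rewrite /= pA mul0mx.
have qv : v *m ev C q = v by rewrite /= mulmxA.
pose den := NcAdd (NcConst 1) (NcMul (NcConst (-1)) q).
have tden : total den by move=> n Y; exact: tq.
have evden n (Y : 'I_g -> 'M[k]_n) : ev Y den = 1%:M - ev Y q.
  by rewrite /den /= mul_scalar_mx scaleN1r.
have dinv n (Y : 'I_g -> 'M[k]_n) : defined Y (NcInv den) = (1%:M - ev Y q \in unitmx).
  by rewrite -evden -[RHS]andTb -(tden n Y).
have dr0 : defined (fun _ : 'I_g => 0 : 'M[k]_1) (NcInv den).
  by rewrite dinv q0 subr0 unitmx1.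
have [n [E0 [gam0 [del0 H0]]]] := realization_exists char_k dr0.
have [m [E [gam [del [H cE oE]]]]] := minimal_realization char_k H0.
have LA : Linv E A.
  apply: (defined_Linv char_k H cE oE).
  by rewrite dinv qA subr0 unitmx1.
(* After the exchange of roles the transposed E is a point, to which the inclusion of loci
   applies. *)
have LC : Linv E C by have := Linv_tr (AC _ _ (Linv_tr LA)); rewrite !trtK.
(* t represents (1 - q)^-1 and is defined at C. The identity (1 - q) t = 1 passes from generic
   points of the ray to C itself, where 1 - q kills v. *)
have [t tC Ht] := realizable_at gam del LC.
have := tC; rewrite -{1}(scaled1 C) => /(ev_reg (scaled_reg 1 C))[nt et].
have := tden _ (scaled C 1) => /(ev_reg (scaled_reg 1 C))[_ ed].
have [d0 _] := ev0 e dr0.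
have := d0; rewrite -{1}(scaled0 C) => /(ev_reg (scaled_reg 0 C))[nd _].
have := regmx_eq2 char_k (regmx_mul ed et) (regmx_const 1 1%:M) nt
  (znear_and nd (Linv_scaled_near0 E C)).
rewrite scaled1 evden => inv; case/eqP: (v0).
have vden : v *m (1%:M - ev C q) = 0 by rewrite mulmxBr mulmx1 qv subrr.
suff -> : v = 0 by rewrite mul0mx.
rewrite -[v]mulmx1 -inv ?mulmxA ?vden ?mul0mx // => z tz [dz Lz].
have -> : ev (scaled C z) t = ev (scaled C z) (NcInv den).
  apply: mulmx_colP => u; have eu := solK (u *m gam) Lz.
  by rewrite -(Ht _ _ tz Lz _ _ eu) -(H _ _ dz Lz _ _ eu).
by rewrite /= mulmxV //; case/andP: dz.
Qed.

(** T is rectangular because equality of the sizes is a conclusion to be drawn from it. *)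
Definition similar_tuples d (A : 'I_g -> 'M[k]_d) e (C : 'I_g -> 'M[k]_e) :=
  exists T : 'M[k]_(d, e), [/\ row_free T, row_full T & forall i, A i *m T = T *m C i].

Lemma similar_size d (A : 'I_g -> 'M[k]_d) e (C : 'I_g -> 'M[k]_e) : similar_tuples A C -> d = e.
Proof. by move=> [T [/eqP rf /eqP rF _]]; rewrite -rf. Qed.

Lemma similar_tr d (A : 'I_g -> 'M[k]_d) e (C : 'I_g -> 'M[k]_e) :
  similar_tuples A C -> similar_tuples (trt C) (trt A).
Proof.
move=> [T [rf rF H]]; exists T^T; split; [by rewrite /row_free mxrank_tr | |].
  by rewrite /row_full mxrank_tr.
by move=> i; rewrite -!trmx_mul H.
Qed.

Lemma similar_reg d (F : 'I_g -> 'M[k]_d) e (E : 'I_g -> 'M[k]_e) :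
  similar_tuples F E -> sub_reg E F /\ sub_reg F E.
Proof.
move=> [T [rf rF H]]; have TE i : T *m E i = F i *m T by [].
split=> n X LX; apply: Linv_inj => V eV.
  apply/(row_free_inj rf); rewrite mul0mx; apply: (Lop_eq0 LX).
  by rewrite (Lop_intertwine TE) eV mul0mx.
have e1 : V = V *m pinvmx T *m T by rewrite mulmxKpV // submx_full.
rewrite e1 (_ : V *m _ = 0) ?mul0mx //; apply: (Lop_eq0 LX).
by apply/(row_free_inj rf); rewrite mul0mx -(Lop_intertwine TE) -e1.
Qed.

(** Schur's lemma: the kernel and the image of T are stable. *)
Lemma irr_hom_similar d (A : 'I_g -> 'M[k]_d) e (C : 'I_g -> 'M[k]_e) (T : 'M[k]_(d, e)) :
  irr A -> irr C -> T != 0 -> (forall i, A i *m T = T *m C i) -> similar_tuples A C.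
Proof.
move=> [_ iA] [_ iC] T0 H; exists T; split=> //.
  have sK : stable A (kermx T).
    by move=> i; apply/sub_kermxP; rewrite -mulmxA H mulmxA mulmx_ker mul0mx.
  case: (iA _ sK) => [/eqP|]; first by rewrite kermx_eq0.
  by rewrite -sub1mx => /sub_kermxP; rewrite mul1mx => e0; rewrite e0 eqxx in T0.
have sT : stable C <<T>>%MS.
  move=> i; rewrite (submx_trans (submxMr _ (_ : <<T>> <= T)%MS)) ?genmxE //.
  by rewrite -H submxMl.
case: (iC _ sT) => [e0|].
  by case/eqP: T0; apply/eqP; rewrite -submx0 -e0 genmxE.
by rewrite -!sub1mx genmxE.
Qed.

(* With p(A) of minimal rank among the p with p(C) <> 0, the assignment
   u p(A) h(A) |-> v p(C) h(C) is a well-defined homomorphism. *)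
Lemma sub_ker_similar d (A : 'I_g -> 'M[k]_d) e (C : 'I_g -> 'M[k]_e) :
  irr A -> irr C -> sub_ker A C -> similar_tuples A C.
Proof.
move=> iA iC AC; have [[i0 Ci0] _] := iC.
pose P m := `[< exists p, [/\ pol0 p, ev C p != 0 & \rank (ev A p) = m] >].
have exP : exists m, P m.
  by exists (\rank (A i0)); apply/asboolP; exists (NcVar i0); split=> //; exact: pol0_var.
case: (ex_minnP exP) => m /asboolP[p [p0 pC rp]] minm.
have [v v0] : exists v : 'rV_e, v *m ev C p != 0.
  by have /rowV0Pn[w /submxP[v ev] w0] := pC; exists v; rewrite -ev.
have pA : ev A p != 0 by apply: contraNneq pC => /(AC _ p0) ->.
have [u u0] : exists u : 'rV_d, u *m ev A p != 0.
  by have /rowV0Pn[w /submxP[u ev] w0] := pA; exists u; rewrite -ev.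
(* Well-definedness. Otherwise p h would compete with p, although its value at A has smaller rank:
   h(A) kills the nonzero row u p(A). *)
have killed h : pol0 h -> u *m ev A p *m ev A h = 0 -> v *m ev C p *m ev C h = 0.
  move=> h0 uh; apply/eqP/negPn/negP => nz.
  have : P (\rank (ev A (NcMul p h))).
    apply/asboolP; exists (NcMul p h); split=> //; first exact: pol0_mul.
    by apply: contraNneq nz => /= e0; rewrite -mulmxA e0 mulmx0.
  move/minm; rewrite /= -rp leqNgt => /negP; apply.
  rewrite -(mxrank_mul_ker (ev A p) (ev A h)) -[X in (X < _)%N]addn0 ltn_add2l lt0n.
  rewrite mxrank_eq0; apply: contraNneq u0 => e0; rewrite -submx0 -e0 sub_capmx submxMl.
  exact/sub_kermxP.
have /choice[hh Hh] : forall a : 'I_d, exists h, pol0 h /\ u *m ev A p *m ev A h = delta_mx 0 a.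
  by move=> a; have [h h0 e1] := irr_cyclic (delta_mx 0 a) iA u0; exists h.
pose T : 'M[k]_(d, e) := \matrix_a (v *m ev C p *m ev C (hh a)).
have HT h : pol0 h -> u *m ev A p *m ev A h *m T = v *m ev C p *m ev C h.
  move=> h0; set y := u *m ev A p *m ev A h.
  (* Subtracts from h the combination of the [hh a] that has the same effect on u p(A), so that
     [killed] applies. *)
  pose h' := NcAdd h (\big[@NcAdd k g/NcConst 0]_(a < d) NcMul (NcConst (- y 0 a)) (hh a)).
  have h'0 : pol0 h'.
    by apply: pol0_add => //; apply: pol0_sum => a; apply: pol0_scale; exact: (Hh a).1.
  have evh' n (Y : 'I_g -> 'M[k]_n) (w : 'rV_n) :
      w *m ev Y h' = w *m ev Y h - \sum_a y 0 a *: (w *m ev Y (hh a)).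
    rewrite /= ev_sum mulmxDr mulmx_sumr -sumrN; congr (_ + _); apply: eq_bigr => a _ /=.
    by rewrite mul_scalar_mx -scalemxAr scaleNr.
  have yh' : u *m ev A p *m ev A h' = 0.
    rewrite evh' -/y {1}[y]row_sum_delta; apply/eqP; rewrite subr_eq0; apply/eqP.
    by apply: eq_bigr => a _; rewrite (Hh a).2.
  have /eqP := killed _ h'0 yh'; rewrite evh' subr_eq0 => /eqP ->.
  by rewrite mulmx_sum_row; apply: eq_bigr => a _; rewrite rowK.
have Trow a : delta_mx 0 a *m T = v *m ev C p *m ev C (hh a) by rewrite -rowE rowK.
apply: (irr_hom_similar (T := T) iA iC) => [|i].
  have [h h0 eh] := irr_cyclic v iC v0.
  apply: contraNneq v0 => e0; rewrite -eh -(HT _ h0) e0 !mulmx0 mul0mx //.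
apply/row_matrixP => a; rewrite !rowE !mulmxA Trow -(Hh a).2.
have := HT (NcMul (hh a) (NcVar i)); rewrite /= !mulmxA; apply.
exact: pol0_mul (Hh a).1 (pol0_var i).
Qed.

Lemma irr_reg_similar d (F : 'I_g -> 'M[k]_d) e (E : 'I_g -> 'M[k]_e) :
  irr F -> irr E -> sub_reg F E -> similar_tuples E F.
Proof.
move=> iF iE FE; rewrite -[E]trtK -[F]trtK; apply: similar_tr.
apply: sub_ker_similar; [exact: irr_tr | exact: irr_tr |].
by apply: sub_reg_ker; rewrite ?trtK //; exact: irr_tr.
Qed.

End IrreducibleTuples.

(** * Composition factors *)

Section Composition.
Variables (k : fieldType) (g : nat).
Hypothesis char_k : [pchar k] =i pred0.
Implicit Types (r s p h : ncexpr k g).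

Definition always d (F : 'I_g -> 'M[k]_d) := forall n (X : 'I_g -> 'M[k]_n), Linv F X.

(** A composition series reduced to its consequences: the factors determine the regular locus,
    satisfy the relations of F, and have smaller size. *)
Inductive composed : forall d, ('I_g -> 'M[k]_d) -> Prop :=
| composed_zero d (F : 'I_g -> 'M[k]_d) : always F -> composed F
| composed_irr d (F : 'I_g -> 'M[k]_d) : irr F -> composed F
| composed_ext d (F : 'I_g -> 'M[k]_d) d1 (F1 : 'I_g -> 'M[k]_d1)
    d2 (F2 : 'I_g -> 'M[k]_d2) :
    composed F1 -> composed F2 -> (d1 < d)%N -> (d2 < d)%N ->
    (forall n (X : 'I_g -> 'M[k]_n), Linv F X = Linv F1 X && Linv F2 X) ->
    sub_ker F F1 -> sub_ker F F2 -> composed F.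

Lemma ev_intertwine d (F : 'I_g -> 'M[k]_d) e (E : 'I_g -> 'M[k]_e) (B : 'M[k]_(e, d)) r :
  (forall i, B *m F i = E i *m B) -> defined F r -> defined E r ->
  B *m ev F r = ev E r *m B.
Proof.
move=> H; elim: r => [a|i|r1 IH1 r2 IH2|r1 IH1 r2 IH2|r1 IH1] //=.
- by rewrite mul_mx_scalar mul_scalar_mx.
- by move=> /andP[F1 F2] /andP[E1 E2]; rewrite mulmxDr mulmxDl IH1 // IH2.
- by move=> /andP[F1 F2] /andP[E1 E2]; rewrite mulmxA IH1 // -!mulmxA IH2.
- move=> /andP[F1 uF] /andP[E1 uE].
  by rewrite -[X in _ = _ *m X](mulmxK uF) (IH1 F1 E1) -!mulmxA mulKmx.
Qed.

Lemma composedP d (F : 'I_g -> 'M[k]_d) : composed F.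
Proof.
elim/ltn_ind: d F => d IH F.
have [|nF] := pselect (irr F); first exact: composed_irr.
have [[i Fi]|F0] := pselect (exists i, F i != 0); last first.
  apply: composed_zero => n X; apply: Linv_inj => V.
  rewrite /Lop Kop_eq0 ?subr0 // => i; apply/eqP/negPn/negP => Fi.
  by apply: F0; exists i.
have [M [sM M0 nM]] : exists M : 'M_d, [/\ stable F M, M != 0 & ~~ row_full M].
  apply: contrapT => H; apply: nF; split=> [|M sM]; first by exists i.
  have [->|M0] := eqVneq M 0; [by left | right].
  by apply/negPn/negP => nM; apply: H; exists M.
have [F1 H1] := stable_sub sM; have [F2 H2] := stable_quo sM.
have rM : (\rank M < d)%N by rewrite ltn_neqAle rank_leq_col andbT.
have rQ : (\rank (cokermx M) < d)%N.
  by rewrite mxrank_coker ltn_subrL (leq_trans _ rM) // lt0n mxrank_eq0 M0.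
have QM : row_base M *m quo_mx M = 0 by apply/eqP; rewrite quo_mx_eq0 eq_row_base.
have Qfull : row_full (quo_mx M) by exact: col_base_full.
apply: (composed_ext (IH _ rM F1) (IH _ rQ F2)) => // [n X|p p0 pF|p p0 pF].
- apply/idP/andP => [LF|[L1 L2]].
    have L1 : Linv F1 X.
      apply: Linv_inj => V eV; apply/(row_free_inj (row_base_free M)); rewrite mul0mx.
      by apply: (Lop_eq0 LF); rewrite (Lop_intertwine H1) eV mul0mx.
    split=> //; apply: Linv_surj => U.
    exists (sol F X (U *m pinvmx (quo_mx M)) *m quo_mx M).
    rewrite (@Lop_intertwine _ _ _ _ _ F) ?solK //.
    by rewrite mulmxKpV // submx_full.
  apply: Linv_inj => V eV.
  have /eqP : V *m quo_mx M = 0.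
    by apply: (Lop_eq0 L2); rewrite (@Lop_intertwine _ _ _ _ _ F) ?eV ?mul0mx.
  rewrite quo_mx_eq0 -(eq_row_base M) => /submxP[W eW]; rewrite eW in eV *.
  rewrite (_ : W = 0) ?mul0mx //; apply: (Lop_eq0 L1).
  apply/(row_free_inj (row_base_free M)).
  by rewrite -(Lop_intertwine H1) eV mul0mx.
- apply/(row_free_inj (row_base_free M)); rewrite mul0mx.
  by rewrite -(ev_intertwine H1) ?pF ?mulmx0 //; exact: pol0_total.
- rewrite -[LHS]mul1mx -(mulVpmx Qfull) -mulmxA.
  rewrite (@ev_intertwine _ F2 _ F) ?pF ?mul0mx ?mulmx0 //; exact: pol0_total.
Qed.

(** An irreducible factor of F is regular wherever A is, hence similar to A. The size bound gives
    minimality of irreducible pencils. *)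
Lemma factor_of_irr d (A : 'I_g -> 'M[k]_d) e (F : 'I_g -> 'M[k]_e) :
  irr A -> sub_reg A F -> always F \/ (sub_reg F A /\ (d <= e)%N).
Proof.
move=> iA; elim: {e F}(composedP F) => [e F aF|e F iF|e F d1 F1 d2 F2 _ IH1 _ IH2 l1 l2 eL _ _] AF.
- by left.
- right; have sFA := irr_reg_similar char_k iA iF AF.
  by split; [exact: (similar_reg sFA).2 | rewrite (similar_size sFA)].
have [|a1|[s1 le1]] := IH1; first by move=> n X /AF; rewrite eL => /andP[].
  have [|a2|[s2 le2]] := IH2; first by move=> n X /AF; rewrite eL => /andP[].
    by left=> n X; rewrite eL a1 a2.
  right; split; last exact: leq_trans le2 (ltnW l2).
  by move=> n X; rewrite eL => /andP[_ /s2].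
right; split; last exact: leq_trans le1 (ltnW l1).
by move=> n X; rewrite eL => /andP[/s1].
Qed.

(** By [hom], irreducible factors have the same relations as F and are therefore similar, so one of
    them determines the locus of G. Equality of sizes excludes a proper factor, whence the clause on
    [c = e]. *)
Lemma homogeneous_factor d (F : 'I_g -> 'M[k]_d) e (G : 'I_g -> 'M[k]_e) :
  (forall c (C : 'I_g -> 'M[k]_c), irr C -> sub_ker F C -> sub_ker C F) ->
  sub_ker F G -> always G \/
  exists c (C : 'I_g -> 'M[k]_c), [/\ irr C, sub_ker F C, (c <= e)%N,
    (c = e -> irr G) & sub_reg G C /\ sub_reg C G].
Proof.
move=> hom; elim: {e G}(composedP G) =>
  [e G aG|e G iG|e G d1 G1 d2 G2 _ IH1 _ IH2 l1 l2 eL k1 k2] FG.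
- by left.
- by right; exists e, G; split=> //; split=> n X.
have FG1 : sub_ker F G1 by move=> p p0 pF; apply: k1 => //; exact: FG.
have FG2 : sub_ker F G2 by move=> p p0 pF; apply: k2 => //; exact: FG.
have {}IH1 := IH1 FG1; have {}IH2 := IH2 FG2.
case: IH1 IH2 => [a1|[c1 [C1 [i1 f1 e1 _ [r1 r1']]]]] [a2|[c2 [C2 [i2 f2 e2 _ [r2 r2']]]]].
- by left=> n X; rewrite eL a1 a2.
- right; exists c2, C2; split=> //; first exact: leq_trans e2 (ltnW l2).
    by move=> ec; rewrite ec leqNgt l2 in e2.
  by split=> n X; rewrite eL a1; [exact: r2 | exact: r2'].
- right; exists c1, C1; split=> //; first exact: leq_trans e1 (ltnW l1).
    by move=> ec; rewrite ec leqNgt l1 in e1.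
  by split=> n X; rewrite eL a2 andbT; [exact: r1 | exact: r1'].
- right; exists c1, C1; split=> //; first exact: leq_trans e1 (ltnW l1).
    by move=> ec; rewrite ec leqNgt l1 in e1.
  have sim : similar_tuples C1 C2.
    apply: (sub_ker_similar i1 i2) => p p0 pC; apply: f2 => //.
    exact: (hom _ _ i1 f1).
  split=> n X; rewrite eL; first by case/andP=> /r1.
  by move=> L; rewrite r1' // r2' //; exact: (similar_reg sim).2.
Qed.

End Composition.

(** * Irreducible pencils *)

Section Pencils.
Variables (k : fieldType) (g : nat).
Hypothesis char_k : [pchar k] =i pred0.

Lemma sub_reg_tr d (F : 'I_g -> 'M[k]_d) e (E : 'I_g -> 'M[k]_e) :
  sub_reg F E -> sub_reg (trt F) (trt E).
Proof.
move=> FE n X /Linv_adjoint; rewrite trtK => /FE/Linv_adjoint.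
by rewrite trtK.
Qed.

Lemma irr_not_always d (F : 'I_g -> 'M[k]_d) : irr F -> ~ always F.
Proof.
move=> iF aF; have [[i /eqP Fi] _] := iF; apply: Fi.
(* Every polynomial vanishes at the tuple of size 0, so an everywhere regular F would satisfy
   [F i = 0]. *)
pose Z : 'I_g -> 'M[k]_0 := fun=> 0.
have ZF : sub_reg (trt Z) (trt F) by apply: sub_reg_tr => n X _; exact: aF.
by have := sub_reg_ker char_k iF ZF (pol0_var _ i); apply; exact: flatmx0.
Qed.

Lemma pol0_generated d (A : 'I_g -> 'M[k]_d) p : pol0 p -> generated_alg A (ev A p).
Proof.
elim=> [|i|{}p q _ gp _ gq|a {}p _ gp|{}p q _ gp _ gq] /=.
- by rewrite raddf0; exact: gen_zero.
- exact: gen_coef.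
- exact: gen_add.
- by rewrite mul_scalar_mx; exact: gen_scale.
- exact: gen_mul.
Qed.

Lemma generated_pol0 d (A : 'I_g -> 'M[k]_d) U :
  generated_alg A U -> exists2 p, pol0 p & U = ev A p.
Proof.
elim=> [i||{}U V _ [p p0 ->] _ [q q0 ->]|a {}U _ [p p0 ->]|{}U V _ [p p0 ->] _ [q q0 ->]].
- by exists (NcVar i) => //; exact: pol0_var.
- by exists (NcConst 0); [exact: pol0_zero | rewrite /= raddf0].
- by exists (NcAdd p q) => //; exact: pol0_add.
- by exists (NcMul (NcConst a) p); [exact: pol0_scale | rewrite /= mul_scalar_mx].
- by exists (NcMul p q) => //; exact: pol0_mul.
Qed.

(** The values p(A) with p(C) = 0 form an ideal. It is proper, since [A i0] = p(A) would give [C i0]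
    = p(C) = 0; so it is 0. *)
Lemma simple_sub_ker d (A : 'I_g -> 'M[k]_d) e (C : 'I_g -> 'M[k]_e) :
  simple_alg (generated_alg A) -> irr C -> sub_ker A C -> sub_ker C A.
Proof.
move=> [_ simple] [[i0 Ci0] _] AC.
pose J : set 'M[k]_d := [set U | exists p, [/\ pol0 p, ev C p = 0 & U = ev A p]].
have [|J0 p p0 pC|JS] := simple J.
- split=> [U [p [p0 _ ->]]||a U V [p [p0 pC ->]] [q [q0 qC ->]]|U V /generated_pol0[q q0 ->] [p [p0 pC ->]]].
  + exact: pol0_generated.
  + by exists (NcConst 0); split; [exact: pol0_zero | rewrite /= raddf0 ..].
  + exists (NcAdd (NcMul (NcConst a) p) q); split.
    * exact/pol0_add/q0/pol0_scale.
    * by rewrite /= pC qC mulmx0 addr0.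
    * by rewrite /= mul_scalar_mx.
  + split; [exists (NcMul q p) | exists (NcMul p q)]; split=> //; try exact: pol0_mul.
      by rewrite /= pC mulmx0.
    by rewrite /= pC mul0mx.
- have : J (ev A p) by exists p.
  by rewrite J0.
- have : J (A i0) by rewrite JS; exact: gen_coef.
  move=> [p [p0 pC Ap]]; case/eqP: Ci0.
  have := AC (NcAdd (NcVar i0) (NcMul (NcConst (-1)) p)).
  rewrite /= pC mulmx0 addr0; apply; last by rewrite mul_scalar_mx scaleN1r Ap subrr.
  exact/pol0_add/pol0_scale/p0/pol0_var.
Qed.

Lemma locus_reg d (A : 'I_g -> 'M[k]_d) e (B : 'I_g -> 'M[k]_e) :
  free_locus B = free_locus A <->
  forall n (X : 'I_g -> 'M[k]_n), Linv (trt B) X = Linv (trt A) X.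
Proof.
split=> [eBA [|n] X|eBA]; first by rewrite !Linv_size0.
  apply: negb_inj; apply/idP/idP => /free_locusE; first by rewrite eBA => /free_locusE.
  by rewrite -eBA => /free_locusE.
apply/seteqP; split=> -[n X] /free_locusE L; apply/free_locusE; first by rewrite -eBA.
by rewrite eBA.
Qed.

(** Simplicity of the algebra makes all irreducible factors similar, so a single factor has the
    locus of A, and minimality forces it to have the full size. *)
Lemma irreducible_pencil_irr d (A : 'I_g -> 'M[k]_d) :
  irreducible_pencil A -> irr (trt A).
Proof.
move=> [min simple]; apply: irr_tr; have [[U [V [_ _ UV]]] _] := simple.
have AA : sub_ker A A by [].
have [aA|[c [C [iC AC le_cd irrA [rAC rCA]]]]] :=
    homogeneous_factor (fun c C => simple_sub_ker simple) AA; last first.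
  apply: irrA; apply/eqP; rewrite eqn_leq le_cd /=; apply: (min c C).
  by apply/locus_reg => n X; apply/idP/idP; exact: sub_reg_tr.
(* An everywhere invertible pencil has the locus of the pencil of size 0, so minimality gives d = 0,
   against the nonzero product. *)
case/eqP: UV; have d0 : d = 0%N.
  apply/eqP; rewrite -leqn0; apply: (min 0%N (fun=> 0)).
  apply/locus_reg => n X; rewrite Linv_inj; last by move=> W _; exact: thinmx0.
  by have := Linv_adjoint (aA _ (trt X)); rewrite trtK.
by move: (U *m V); rewrite d0 => W; exact: flatmx0.
Qed.

(** The field need not be algebraically closed, so the algebra may be smaller than the full matrix
    algebra. A nonzero ideal still moves any nonzero row to any row, and this suffices to find the
    identity matrix in it. *)
Lemma irr_simple d (A : 'I_g -> 'M[k]_d) : irr A -> simple_alg (generated_alg A).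
Proof.
move=> iA; have [[i Ai] _] := iA; split.
  have /rowV0Pn[w /submxP[v ew] w0] := Ai.
  have [p p0 wp] := irr_cyclic w iA w0.
  exists (A i), (ev A p); split; [exact: gen_coef | exact: pol0_generated |].
  by apply: contraNneq w0 => e0; rewrite -wp ew -mulmxA e0 mulmx0.
move=> J [JS J0 JD JM].
have [[U JU U0]|J00] := pselect (exists2 U, J U & U != 0); last first.
  left; apply/seteqP; split=> [U JU|U ->] //=.
  by apply/eqP/negPn/negP => U0; apply: J00; exists U.
right; have gen p : pol0 p -> generated_alg A (ev A p) by exact: pol0_generated.
have cyc (v u : 'rV_d) : v != 0 -> exists2 h, J h & v *m h = u.
  move=> v0; have /rowV0Pn[_ /submxP[w ->] w0] := U0.
  have [p p0 vp] := irr_cyclic w iA v0; have [q q0 wq] := irr_cyclic u iA w0.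
  exists (ev A p *m U *m ev A q); last by rewrite !mulmxA vp.
  by apply: (JM _ _ (gen _ q0) _).2; apply: (JM _ _ (gen _ p0) _).1.
(* An element e of J with 1 - e of minimal rank is the identity: otherwise
   w(1 - e) <> 0 is fixed by some h in J, and (1 - e)(1 - h) has smaller rank. *)
pose P m := `[< exists2 e, J e & \rank (1%:M - e) = m >].
have exP : exists m, P m by eexists; apply/asboolP; exists 0.
case: (ex_minnP exP) => m /asboolP[e Je re] minm.
have J1 : J 1%:M.
  suff /eqP : 1%:M - e == 0 by move/subr0_eq ->.
  apply/negPn/negP => /rowV0Pn[_ /submxP[w ->] w0].
  have [h Jh hw] := cyc _ (w *m (1%:M - e)) w0.
  have Jeh : J (e + h - e *m h).
    rewrite addrC -scaleN1r; apply: (JD (-1)); first by apply: (JM _ _ (JS _ Je) Jh).1.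
    by rewrite -[e]scale1r; apply: JD.
  have : P (\rank (1%:M - (e + h - e *m h))) by apply/asboolP; exists (e + h - e *m h).
  move/minm; rewrite -re leqNgt => /negP; apply.
  have -> : 1%:M - (e + h - e *m h) = (1%:M - e) *m (1%:M - h).
    by rewrite mulmxBr mulmx1 mulmxBl mul1mx -[in LHS]addrA opprD [in LHS]addrA.
  rewrite -(mxrank_mul_ker (1%:M - e) (1%:M - h)) -[X in (X < _)%N]addn0 ltn_add2l lt0n.
  rewrite mxrank_eq0; apply: contraNneq w0 => e0; rewrite -submx0 -e0 sub_capmx submxMl.
  by apply/sub_kermxP; rewrite mulmxBr mulmx1 hw subrr.
apply/seteqP; split=> // V SV; rewrite -[V]mulmx1.
exact: (JM _ _ SV J1).1.
Qed.

Lemma irr_irreducible_pencil d (A : 'I_g -> 'M[k]_d) :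
  irr (trt A) -> irreducible_pencil A.
Proof.
move=> iA; split; last by apply: irr_simple; rewrite -[A]trtK; exact: irr_tr.
move=> e B /locus_reg eB.
have sB : sub_reg (trt A) (trt B) by move=> n X; rewrite eB.
have [aB|[_ //]] := factor_of_irr char_k iA sB.
by case: (irr_not_always iA) => n X; rewrite -eB.
Qed.

End Pencils.

(** * Co-irreducible domains *)

Section Domains.
Variables (k : fieldType) (g : nat).
Hypothesis char_k : [pchar k] =i pred0.
Implicit Types (f : ncratfun k g).

Lemma ctrl_tr_obs d (F : 'I_g -> 'M[k]_d) (del : 'cV[k]_d) :
  ctrl (trt F) del^T -> obs F del.
Proof.
move=> H M sM Md; have sK : stable (trt F) (kermx M^T) by apply: stable_tr; rewrite trtK.
have dK : (del^T <= kermx M^T)%MS by apply/sub_kermxP; rewrite -trmx_mul Md trmx0.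
have := H _ sK dK; rewrite -sub1mx => /sub_kermxP; rewrite mul1mx => /eqP.
by rewrite trmx_eq0 => /eqP.
Qed.

Lemma irr_quotient_reg d (F : 'I_g -> 'M[k]_d) e (E : 'I_g -> 'M[k]_e) (T : 'M[k]_(e, d)) :
  irr F -> T != 0 -> (forall i, E i *m T = T *m F i) -> sub_reg E F.
Proof.
move=> [_ iF] T0 H n X LE.
have sT : stable F <<T>>%MS.
  move=> i; rewrite (submx_trans (submxMr _ (_ : <<T>> <= T)%MS)) ?genmxE //.
  by rewrite -H submxMl.
have fT : row_full T.
  case: (iF _ sT) => [e0|]; last by rewrite -!sub1mx genmxE.
  by case/eqP: T0; apply/eqP; rewrite -submx0 -e0 genmxE.
apply: Linv_surj => U; exists (sol E X (U *m pinvmx T) *m T).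
by rewrite (@Lop_intertwine _ _ _ _ _ E) ?solK // mulmxKpV // submx_full.
Qed.

(* A stable subspace containing (gamF, gam) either contains the first summand or
   is the graph of a homomorphism E -> F. *)
Lemma ctrl_dsum d (F : 'I_g -> 'M[k]_d) e (E : 'I_g -> 'M[k]_e) gamF gam :
  irr F -> gamF != 0 -> ctrl E gam -> ~ sub_reg E F ->
  ctrl (dsum F E) (row_mx gamF gam).
Proof.
move=> iF gF0 cE nEF M sM gM.
have pairE (v : 'rV_d) (w : 'rV_e) i : row_mx v w *m dsum F E i = row_mx (v *m F i) (w *m E i).
  by rewrite /dsum mul_row_block !mulmx0 addr0 add0r.
have full2 : row_full (M *m col_mx 0 1%:M : 'M_(d + e, e)).
  rewrite -sub1mx -(genmxE (M *m _)) sub1mx; apply: cE; last first.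
    by rewrite genmxE; have := submxMr (col_mx 0 1%:M) gM; rewrite mul_row_col mulmx0 mulmx1 add0r.
  move=> i; rewrite (submx_trans (submxMr _ (_ : _ <= M *m col_mx 0 1%:M)%MS)) ?genmxE //.
  have := submxMr (col_mx 0 1%:M) (sM i).
  by rewrite -!mulmxA /dsum mul_block_col mul_col_mx !mulmx0 !mul0mx mul1mx mulmx1 !add0r.
have lift2 (w : 'rV_e) : exists v : 'rV_d, (row_mx v w <= M)%MS.
  have /submxP[D ->] : (w <= M *m col_mx 0 1%:M)%MS by rewrite submx_full.
  exists (lsubmx (D *m M)); rewrite mulmxA -[D *m M in X in row_mx _ X]hsubmxK.
  by rewrite mul_row_col mulmx0 mulmx1 add0r hsubmxK submxMl.
have [||N HN] := @subspace_mx k d (fun v => row_mx v (0 : 'rV_e) <= M)%MS.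
- by rewrite row_mx0 sub0mx.
- move=> a u v uM vM; rewrite -[0](addr0 (0 : 'rV[k]_e)) -{1}(scaler0 _ a) -add_row_mx.
  by rewrite -scale_row_mx addmx_sub // scalemx_sub.
have sN : stable F N.
  move=> i; apply/row_subP => j; rewrite row_mul; apply/HN.
  have := (HN (row j N)).2 (row_sub _ _) => /(submxMr (dsum F E i)).
  by rewrite pairE mul0mx => /submx_trans; apply.
have subE (v v' : 'rV_d) (w w' : 'rV_e) :
    row_mx v w - row_mx v' w' = row_mx (v - v') (w - w').
  by rewrite opp_row_mx add_row_mx.
(* N is the intersection of M with the first summand. If it is everything, then M is full by
   [lift2]; if it is 0, then M is the graph of T, and T is nonzero because [gamF] is. *)
case: (iF.2 N sN) => [N0|fN]; last first.
  rewrite -sub1mx; apply/row_subP => j; rewrite -[row j _]hsubmxK.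
  set v := lsubmx _; set w := rsubmx _; have [v' v'w] := lift2 w.
  rewrite -[row_mx v w](subrK (row_mx v' w)) subE subrr addmx_sub //.
  by apply/HN; rewrite submx_full.
  have /choice[t Ht] := fun j : 'I_e => lift2 (delta_mx 0 j).
  pose T : 'M[k]_(e, d) := \matrix_j t j.
  have HT (w : 'rV_e) : (row_mx (w *m T) w <= M)%MS.
    rewrite mulmx_sum_row {2}[w]row_sum_delta.
    have -> : row_mx (\sum_i w 0 i *: row i T) (\sum_j w 0 j *: delta_mx 0 j)
       = \sum_i w 0 i *: row_mx (t i) (delta_mx 0 i).
      apply/rowP => c; rewrite summxE; case: (split_ordP c) => c' ->.
        by rewrite row_mxEl summxE; apply: eq_bigr => i _; rewrite [RHS]mxE row_mxEl !mxE.
      by rewrite row_mxEr summxE; apply: eq_bigr => i _; rewrite [RHS]mxE row_mxEr mxE.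
    by apply: summx_sub => i _; rewrite scalemx_sub.
  have graph (v : 'rV_d) (w : 'rV_e) : (row_mx v w <= M)%MS -> v = w *m T.
    move=> vw; apply/eqP; rewrite -subr_eq0 -submx0 -N0; apply/HN.
    by rewrite -(subrr w) -subE addmx_sub // eqmx_opp.
case: nEF; apply: (irr_quotient_reg (T := T)) => // [|i].
  by apply: contraNneq gF0 => T0; rewrite (graph _ _ gM) T0 mulmx0.
apply/row_matrixP => j; rewrite !row_mul rowK (rowE j (E i)); apply/esym/graph.
by rewrite -pairE (submx_trans (submxMr _ (Ht j))).
Qed.

Lemma Linv_dsum d (F : 'I_g -> 'M[k]_d) e (E : 'I_g -> 'M[k]_e) n (X : 'I_g -> 'M[k]_n) :
  Linv (dsum F E) X = Linv F X && Linv E X.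
Proof.
apply/idP/andP => [L|[LF LE]]; last first.
  apply: Linv_inj => V; rewrite -[V]hsubmxK Lop_dsum -row_mx0.
  by case/eq_row_mx => /(Lop_eq0 LF) -> /(Lop_eq0 LE) ->.
split; apply: Linv_inj => V eV.
  have : row_mx V 0 = 0 :> 'M_(n, d + e).
    apply: (Lop_eq0 L); rewrite Lop_dsum eV /Lop /Kop big1 ?subr0 ?row_mx0 // => i _.
    by rewrite mulmx0 mul0mx.
  by rewrite -row_mx0 => /eq_row_mx[].
have : row_mx 0 V = 0 :> 'M_(n, d + e).
  apply: (Lop_eq0 L); rewrite Lop_dsum eV /Lop /Kop big1 ?subr0 ?row_mx0 // => i _.
  by rewrite mulmx0 mul0mx.
by rewrite -row_mx0 => /eq_row_mx[].
Qed.

Lemma irr_nonzero d (F : 'I_g -> 'M[k]_d) : irr F ->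
  (exists v : 'rV[k]_d, v != 0) /\ (exists v : 'cV[k]_d, v != 0).
Proof.
case: d F => [|d] F /irr_gt0 // _; have o1 : (1 : k) != 0 by exact: oner_neq0.
split; exists (const_mx 1); first by apply: contraNneq o1 => /rowP/(_ 0); rewrite !mxE => ->.
by apply: contraNneq o1 => /colP/(_ 0); rewrite !mxE => ->.
Qed.

(** Cuts a domain down by the locus of F while keeping the realization minimal. An irreducible
    factor regular wherever E is adds nothing; any other one can be added as a direct summand. *)
Lemma add_factors d (F : 'I_g -> 'M[k]_d) e (E : 'I_g -> 'M[k]_e) gam del :
  ctrl E gam -> obs E del ->
  exists e' (E' : 'I_g -> 'M[k]_e') gam' del', [/\ ctrl E' gam', obs E' del' &
    forall n (X : 'I_g -> 'M[k]_n), Linv E' X = Linv E X && Linv F X].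
Proof.
elim: {d F}(composedP F) e E gam del =>
  [d F aF|d F iF|d F d1 F1 d2 F2 _ IH1 _ IH2 _ _ eF _ _] e E gam del cE oE.
- by exists e, E, gam, del; split=> // n X; rewrite aF andbT.
- have [sEF|nEF] := pselect (sub_reg E F).
    exists e, E, gam, del; split=> // n X.
    by case LE: (Linv E X) => //=; rewrite sEF.
  have [[v v0] [w w0]] := irr_nonzero iF.
  exists (d + e)%N, (dsum F E), (row_mx v gam), (col_mx w del); split.
  + exact: ctrl_dsum.
  + apply: ctrl_tr_obs; rewrite tr_col_mx.
    have -> : trt (dsum F E) = dsum (trt F) (trt E).
      by apply/funext => i; rewrite /trt /dsum tr_block_mx !trmx0.
    apply: ctrl_dsum; rewrite ?trmx_eq0 //; [exact: irr_tr | exact: obs_tr |].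
    by move/sub_reg_tr; rewrite !trtK.
  + by move=> n X; rewrite Linv_dsum andbC.
have [e1 [E1 [gam1 [del1 [c1 o1 H1]]]]] := IH1 _ _ _ _ cE oE.
have [e2 [E2 [gam2 [del2 [c2 o2 H2]]]]] := IH2 _ _ _ _ c1 o1.
by exists e2, E2, gam2, del2; split=> // n X; rewrite H2 H1 eF andbA.
Qed.

Definition reg_locus d (F : 'I_g -> 'M[k]_d) : set (mtuple k g) :=
  [set X | Linv F (projT2 X)].

Lemma dom_reg_locus f d (F : 'I_g -> 'M[k]_d) gam del :
  freal f F gam del -> ctrl F gam -> obs F del -> dom f = reg_locus F.
Proof.
by move=> Hf cF oF; apply/seteqP; split=> -[n X] /(dom_freal char_k X Hf cF oF).
Qed.

Lemma reg_locus_eq d (F : 'I_g -> 'M[k]_d) e (E : 'I_g -> 'M[k]_e) :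
  reg_locus F `<=` reg_locus E -> sub_reg F E.
Proof.
move=> FE [|n] X LX; first exact: Linv_size0.
exact: (FE (existT (fun n => 'I_g -> 'M[k]_n.+1) n X)).
Qed.

(** Starts from the realization of size 0, regular everywhere, and adds the composition factors of
    F. *)
Lemma Dom0_reg_locus d (F : 'I_g -> 'M[k]_d) : Dom0 (reg_locus F).
Proof.
have c0 : ctrl (fun _ : 'I_g => 0 : 'M[k]_0) 0 by move=> M _ _; rewrite /row_full eqn_leq rank_leq_col.
have o0 : obs (fun _ : 'I_g => 0 : 'M[k]_0) 0 by move=> M _ _; exact: flatmx0.
have [e [E [gam [del [cE oE EF]]]]] := add_factors F c0 o0.
have [f Hf] := freal_exists E gam del.
exists f; first exact: (freal_origin char_k Hf).
rewrite (dom_reg_locus Hf cE oE); apply/seteqP; split=> -[n X]; rewrite /reg_locus /= EF.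
  by move=> ->; rewrite andbT; apply: Linv_inj => V _; exact: thinmx0.
by case/andP.
Qed.

Lemma coirreducible_factor d (F : 'I_g -> 'M[k]_d) : coirreducible (reg_locus F) ->
  exists e (E : 'I_g -> 'M[k]_e), irr E /\ reg_locus E = reg_locus F.
Proof.
elim: {d F}(composedP F) => [d F aF|d F iF|d F d1 F1 d2 F2 _ IH1 _ IH2 _ _ eF _ _] coF.
- case: coF => _ []; apply/seteqP; split=> // X _; exact: aF.
- by exists d, F.
have e12 : reg_locus F = reg_locus F1 `&` reg_locus F2.
  apply/seteqP; split=> [X|X []]; rewrite /reg_locus /= eF; first by case/andP.
  by move=> -> ->.
have [e1|n1] := pselect (reg_locus F1 = reg_locus F).
  by rewrite -e1; apply: IH1; rewrite e1.
have [e2|n2] := pselect (reg_locus F2 = reg_locus F).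
  by rewrite -e2; apply: IH2; rewrite e2.
case: coF => _ _ []; exists (reg_locus F1), (reg_locus F2).
split=> //; try exact: Dom0_reg_locus.
  split=> [|s1]; first by rewrite e12; exact: subIsetl.
  by apply: n1; apply/seteqP; split=> //; rewrite e12; exact: subIsetl.
split=> [|s1]; first by rewrite e12; exact: subIsetr.
by apply: n2; apply/seteqP; split=> //; rewrite e12; exact: subIsetr.
Qed.

Lemma irreducible_fun_freal f : irreducible_fun f ->
  exists d (F : 'I_g -> 'M[k]_d) gam del,
    [/\ irr F, freal f F gam del, gam != 0, del != 0 & dom f = reg_locus F].
Proof.
move=> [f0 _ [d [A [b [c [iA /(has_realizationE char_k) Hf]]]]]].
have iF := irreducible_pencil_irr iA.
have b0 : b^T != 0 by apply: contra_notN f0 => /eqP b0; apply: (zero_freal char_k Hf); left.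
have c0 : c != 0 by apply: contra_notN f0 => /eqP c0; apply: (zero_freal char_k Hf); right.
exists d, (trt A), b^T, c; split=> //.
by apply: (dom_reg_locus Hf); [exact: irr_ctrl | exact: irr_obs].
Qed.

Lemma freal_irreducible_fun f d (F : 'I_g -> 'M[k]_d) gam del :
  irr F -> freal f F gam del -> gam != 0 -> del != 0 ->
  irreducible_fun f /\ dom f = reg_locus F.
Proof.
move=> iF Hf g0 d0; have cF := irr_ctrl iF g0.
split; last exact: (dom_reg_locus Hf cF (irr_obs iF d0)).
split; first by move/(freal_zero char_k Hf cF)/eqP; rewrite (negPf d0).
  exact: (freal_origin char_k Hf).
exists d, (trt F), gam^T, del; split; first by apply: irr_irreducible_pencil; rewrite ?trtK.
by apply/(has_realizationE char_k); rewrite trtK trmxK.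
Qed.

Lemma irreducible_coirreducible f : irreducible_fun f -> coirreducible (dom f).
Proof.
move=> irf; have [d [F [gam [del [iF Hf g0 d0 eD]]]]] := irreducible_fun_freal irf.
rewrite eD; split; first exact: Dom0_reg_locus.
  move=> eT; apply: (irr_not_always char_k iF) => -[|n] X; first exact: Linv_size0.
  have : [set: mtuple k g] (existT (fun n => 'I_g -> 'M[k]_n.+1) n X) by [].
  by rewrite -eT.
move=> [D1 [D2 [[f1 or1 ->] [f2 or2 ->]]]].
have [e1 [E1 [ga1 [de1 [H1 c1 o1]]]]] := dom_origin char_k or1.
have [e2 [E2 [ga2 [de2 [H2 c2 o2]]]]] := dom_origin char_k or2.
rewrite (dom_reg_locus H1 c1 o1) (dom_reg_locus H2 c2 o2) => -[s1 n1] [s2 n2] e12.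
(* A domain containing that of F equals it or is everything. Two strictly larger ones are thus both
   everything, and so is their intersection. *)
have [a1|[r1 _]] := factor_of_irr char_k iF (reg_locus_eq s1); last first.
  by apply: n1 => X; apply: r1.
have [a2|[r2 _]] := factor_of_irr char_k iF (reg_locus_eq s2); last first.
  by apply: n2 => X; apply: r2.
apply: (irr_not_always char_k iF) => -[|n] X; first exact: Linv_size0.
have : (reg_locus E1 `&` reg_locus E2) (existT (fun n => 'I_g -> 'M[k]_n.+1) n X).
  by split; [exact: a1 | exact: a2].
by rewrite -e12.
Qed.

Lemma coirreducible_pencil (D : set (mtuple k g)) : coirreducible D ->
  exists d (F : 'I_g -> 'M[k]_d), irr F /\ reg_locus F = D.
Proof.
move=> /[dup] coD [[f orf eD] _ _].
have [d [F [gam [del [Hf cF oF]]]]] := dom_origin char_k orf.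
have eF := dom_reg_locus Hf cF oF; rewrite eD eF; apply: coirreducible_factor.
by rewrite -eF -eD.
Qed.

(** The pencil that comes with f has the same locus as F, hence is similar to it, and the vectors
    are transported along the similarity. *)
Lemma irreducible_fun_locus f d (F : 'I_g -> 'M[k]_d) :
  irr F -> irreducible_fun f -> dom f = reg_locus F ->
  exists gam del, [/\ gam != 0, del != 0 & freal f F gam del].
Proof.
move=> iF irf eD; have f0 : ~ representatives f (NcConst 0) by case: irf.
have [e [E [gam [del [iE Hf _ _ eE]]]]] := irreducible_fun_freal irf.
have sub : sub_reg E F by apply: reg_locus_eq; rewrite -eE eD.
have [T [rT fT FT]] := irr_reg_similar char_k iE iF sub.
have [r fr Hr] := Hf.
have Hf' : freal f F (gam *m pinvmx T) (T *m del).
  exists r => //; apply: (realizes_sub char_k Hr) => [i|]; first by rewrite FT.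
  by rewrite mulmxKpV // submx_full.
exists (gam *m pinvmx T), (T *m del); split=> //.
  by apply: contra_notN f0 => /eqP z0; apply: (zero_freal char_k Hf'); left.
by apply: contra_notN f0 => /eqP z0; apply: (zero_freal char_k Hf'); right.
Qed.

(* If a proper nonzero subspace M were stable, then choosing gam in M and del
   orthogonal to M would give the zero function. *)
Lemma all_irreducible_irr d (F : 'I_g -> 'M[k]_d) gam0 del0 f0 :
  gam0 != 0 -> del0 != 0 -> freal f0 F gam0 del0 -> dom f0 <> setT ->
  (forall f gam del, gam != 0 -> del != 0 -> freal f F gam del ->
     ~ representatives f (NcConst 0)) -> irr F.
Proof.
move=> g0 d0 Hf0 nT H; split.
  apply: contrapT => F0; apply: nT; apply/seteqP; split=> // -[n X] _.
  have LX : Linv F X.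
    apply: Linv_inj => V; rewrite /Lop Kop_eq0 ?subr0 // => i.
    by apply/eqP/negPn/negP => Fi; apply: F0; exists i.
  by have [r [fr rX _]] := freal_at char_k Hf0 LX; apply/domE; exists r.
move=> M sM; have [->|M0] := eqVneq M 0; [by left | right].
apply/negPn/negP => nM.
have [gam gM ga0] := rowV0Pn M0.
have /rowV0Pn[w /submxP[y wy] w0] : (cokermx M)^T != 0.
  rewrite trmx_eq0; apply: contra nM => /eqP c0.
  by rewrite -sub1mx submxE c0 mulmx0.
have Mw : M *m w^T = 0 by rewrite wy trmx_mul trmxK mulmxA mulmx_coker mul0mx.
have [f Hf] := freal_exists F gam w^T.
apply: (H f gam w^T) => //; first by rewrite trmx_eq0.
have [F1 HF1] := stable_sub sM; have [r fr Hr] := Hf.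
have [g1 eg] : exists g1, gam = g1 *m row_base M by apply/submxP; rewrite eq_row_base.
have Hf1 : freal f F1 g1 (row_base M *m w^T) by exists r => //; exact: (realizes_sub char_k Hr).
apply: (zero_freal char_k Hf1); right.
have /submxP[Z ->] : (row_base M <= M)%MS by rewrite eq_row_base.
by rewrite -mulmxA Mw mulmx0.
Qed.

End Domains.

Theorem proposition4p4 (k : fieldType) (g : nat) (char_k : [pchar k] =i pred0) :
  (forall f : ncratfun k g, irreducible_fun f -> coirreducible (dom f)) /\
  (forall D : set (mtuple k g), coirreducible D ->
     exists! d : nat, exists A : 'I_g -> 'M[k]_d,
       forall f : ncratfun k g,
         (irreducible_fun f /\ dom f = D) <->
         (exists b c : 'cV[k]_d,
            [/\ b != 0, c != 0 & has_realization f c A b])).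
Proof.
split=> [f|D coD]; first exact: irreducible_coirreducible.
have [d [F [iF eD]]] := coirreducible_pencil char_k coD.
have [[v v0] [w w0]] := irr_nonzero iF.
have [f0 Hf0] := freal_exists F v w.
have [if0 df0] := freal_irreducible_fun char_k iF Hf0 v0 w0.
exists d; split.
  exists (trt F) => f; split=> [[irf]|[b [c [b0 c0 /(has_realizationE char_k)]]]].
    rewrite -eD => /(irreducible_fun_locus char_k iF irf)[gam [del [g0 d0 Hf]]].
    exists gam^T, del; split; rewrite ?trmx_eq0 //.
    by apply/(has_realizationE char_k); rewrite trtK trmxK.
  rewrite trtK -eD => Hf.
  by apply: (freal_irreducible_fun char_k iF Hf); rewrite ?trmx_eq0.
(* Uniqueness: no nonzero vectors over [A'] give the zero function, which makes [A'] irreducible;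
   having the same locus as F, it is similar to F. *)
move=> d' [A' HA'].
have [b [c [b0 c0 /(has_realizationE char_k) Hb]]] := (HA' f0).1 (conj if0 (etrans df0 eD)).
have iA : irr (trt A').
  apply: (all_irreducible_irr char_k (gam0 := b^T) (del0 := c) (f0 := f0)) => //.
  - by rewrite trmx_eq0.
  - by rewrite df0 eD; case: coD.
  - move=> f gam del g0 d0 Hf; suff [[]] : irreducible_fun f /\ dom f = D by [].
    apply/HA'; exists gam^T, del; split; rewrite ?trmx_eq0 //.
    by apply/(has_realizationE char_k); rewrite trmxK.
have bT0 : b^T != 0 by rewrite trmx_eq0.
have eA := dom_reg_locus char_k Hb (irr_ctrl iA bT0) (irr_obs iA c0).
have sub : sub_reg (trt A') F by apply: reg_locus_eq; rewrite -eA df0.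
exact: similar_size (irr_reg_similar char_k iA iF sub).
Qed.
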